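(* There is an absolute constant $c_1>0$ such that for every positive integer $d$ there exists $c_0=c_0(d)>0$ with the following property. Let $\alpha\in(0,1]$ and let $\mathcal{F}$ be a family of $n$ convex sets in $\mathbb{R}^d$ such that at least $\alpha\binom{n}{2d}$ of the $2d$-element subfamilies $\{A_1,\dots,A_{2d}\}\subseteq\mathcal{F}$ satisfy $\mathrm{vol}(A_1\cap\dots\cap A_{2d})\ge 1$. Then there are at least $c_0\alpha n$ members of $\mathcal{F}$ whose common intersection has volume at least $d^{-c_1 d}$.
   Context: $\mathrm{vol}$ denotes $d$-dimensional Lebesgue measure.
   Formalization: The family is required to have n ≥ 2d members; for 1 ≤ n < 2d the binomial coefficient is zero, the hypothesis holds vacuously, and the claim fails (e.g. n = 1 with a single convex set of volume zero). *)

(* Defs.v *)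
From HB Require Import structures.
From mathcomp Require Import all_boot all_order all_algebra.
From mathcomp Require Import all_classical all_reals all_analysis.
From mathcomp Require Import Rstruct Rstruct_topology.
Set Implicit Arguments. Unset Strict Implicit. Unset Printing Implicit Defensive.
Import Order.TTheory GRing.Theory Num.Theory.
Local Open Scope classical_set_scope.
Local Open Scope ring_scope.

Notation R := Rdefinitions.R.

Definition box_set (d : nat) (B : 'I_d -> R * R) : set 'rV[R]_d :=
  [set x | forall i : 'I_d, (B i).1 <= x ord0 i <= (B i).2].

Definition box_vol (d : nat) (B : 'I_d -> R * R) : R :=
  \prod_(i < d) Num.max ((B i).2 - (B i).1) 0.

(* d-dimensional Lebesgue (outer) measure: infimum of the total volume of
   countable covers by boxes.  On Lebesgue-measurable sets (e.g. convex sets)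
   this is the d-dimensional Lebesgue measure. *)
Definition vol (d : nat) (A : set 'rV[R]_d) : \bar R :=
  ereal_inf [set (\sum_(0 <= k <oo) (box_vol (B k))%:E)%E
            | B in [set B : nat -> 'I_d -> R * R |
                      A `<=` \bigcup_k box_set (B k)]].

Definition subfam_inter (d n : nat) (F : 'I_n -> set 'rV[R]_d)
    (S : {set 'I_n}) : set 'rV[R]_d :=
  [set x | forall i, i \in S -> F i x].

Definition num_good_subfams (d n k : nat) (F : 'I_n -> set 'rV[R]_d) : nat :=
  #|[set S : {set 'I_n} | (#|S| == k) &&
        `[< (1%:E <= vol (subfam_inter F S))%E >] ]|.

(* Main.v *)
(* The volume of a convex set is replaced, up to factors d^O(d), by the largest |det| of a
   simplex it contains: a set with near-maximal simplex T contains T and lies in the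
   parallelepiped of points whose T-coordinates are in [-2, 2].

   Quantitative Helly: let P be the intersection of convex sets D_i, with near-maximal
   simplex T.  In T-coordinates centered at the barycenter of T, P contains the cross-polytope of
   radius 1/(d+1) and lies in the cube [-3, 3]^d.  By Farkas' lemma every functional that is
   at most 1 on P is a convex combination of functionals that are at most 1 on some D_i.
   Applied to e_1/3, ..., e_d/3 this gives functionals g_1, ..., g_d with determinant at least
   3^-d; applied to a multiple of -(g_1 + ... + g_d), with Caratheodory, it gives d more.  The
   at most 2d sets D_i supporting these 2d functionals have an intersection on which all g_k
   are bounded by a polynomial in d, hence of volume at most d^O(d) times that of P.

   Charging: let S be a 2d-subfamily with large intersection.  Lower a horizontal hyperplane as
   far as the part of that intersection below it stays large.  By Helly applied to S and the
   lower half-space, some T = S \ {A} then has a part below the hyperplane that is no longer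
   large.  Some T of size 2d-1 is charged by a fraction alpha of all A; at the highest of the
   corresponding hyperplanes, the part K of the intersection of T has bounded volume and meets
   each of these A in a set of comparable volume.  In the coordinates of a near-maximal
   simplex of K, a grid pigeonhole makes a positive fraction of these A share a simplex.

   In dimension 1 the constant d^(-c_1 d) is exactly 1, so no loss is allowed: a pair of
   intervals is charged to the one with the higher left end, and all intervals charging a
   given one share, up to epsilon, a segment of length 1. *)
Require Import Defs.
From HB Require Import structures.
From mathcomp Require Import all_boot all_order all_algebra.
From mathcomp Require Import perm.
From mathcomp Require Import all_classical all_reals all_analysis.
From mathcomp Require Import Rstruct Rstruct_topology.
From mathcomp Require Import measurable_realfun ring lra zify.
Set Implicit Arguments. Unset Strict Implicit. Unset Printing Implicit Defensive.
Import Order.TTheory GRing.Theory Num.Theory.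
Local Open Scope ring_scope.


(** * Determinants, linear inequalities and convex combinations *)

Definition setrow (K : fieldType) d (M : 'M[K]_d) (i : 'I_d) (v : 'rV[K]_d) : 'M[K]_d :=
  \matrix_(k, l) if k == i then v 0 l else M k l.

Lemma row_setrow (K : fieldType) d (M : 'M[K]_d) i v k :
  row k (setrow M i v) = if k == i then v else row k M.
Proof. by apply/rowP => l; rewrite !mxE; case: eqP => // _; rewrite ?mxE. Qed.

Lemma det_setrow (K : fieldType) d (M : 'M[K]_d) i v :
  \det (setrow M i v) = (v *m \adj M) 0 i.
Proof.
rewrite (expand_det_row _ i) mxE; apply: eq_bigr => l _.
rewrite !mxE eqxx; congr (_ * ((-1) ^+ _ * \det _)).
by apply/matrixP => a b; rewrite !mxE eq_sym (negbTE (neq_lift _ _)).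
Qed.

(** Cramer's rule: coordinates in the basis formed by the rows of [M] are ratios of determinants.
    This turns near-maximality of a simplex into bounds on coordinates. *)
Lemma det_setrow_mulmx (K : fieldType) d (M : 'M[K]_d) i a :
  \det (setrow M i (a *m M)) = a 0 i * \det M.
Proof.
by rewrite det_setrow -mulmxA mul_mx_adj mul_mx_scalar !mxE mulrC.
Qed.

Lemma normr_det_le (K : realFieldType) n (M : 'M[K]_n) (B : K) :
  (forall i j, `|M i j| <= B) -> `|\det M| <= (n`!)%:R * B ^+ n.
Proof.
move=> MB; rewrite /determinant (le_trans (ler_norm_sum _ _ _))//.
have -> : (n`!)%:R * B ^+ n = \sum_(s : 'S_n) B ^+ n.
  by rewrite sumr_const mulr_natl card_Sn.
apply: ler_sum => s _; rewrite normrM normrX normrN1 expr1n mul1r normr_prod.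
rewrite -[leRHS](_ : \prod_(i < n) B = _); last by rewrite prodr_const card_ord.
by apply: ler_prod => i _; rewrite normr_ge0 MB.
Qed.

Lemma normr_adj_le (K : realFieldType) n (M : 'M[K]_n) (B : K) : 1 <= B ->
  (forall i j, `|M i j| <= B) -> forall i j, `|(\adj M) i j| <= (n`!)%:R * B ^+ n.
Proof.
move=> B1 MB i j; rewrite mxE normrM normrX normrN1 expr1n mul1r.
(* A cofactor has size [n.-1]; [1 <= B] allows the bound to be relaxed to size [n]. *)
apply: (@le_trans _ _ ((n.-1)`!%:R * B ^+ n.-1)).
  by apply: normr_det_le => a b; rewrite !mxE.
have n0 : (0 < n)%N by apply: leq_ltn_trans (ltn_ord i).
have B0 : 0 <= B by rewrite (le_trans ler01).
apply: ler_pM; rewrite ?ler0n ?exprn_ge0//; last by rewrite ler_weXn2l// leq_pred.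
by rewrite ler_nat -[X in (_ <= X`!)%N](prednK n0) factS leq_pmull.
Qed.

Definition linear_form (K : realFieldType) (V : lmodType K) (f : V -> K) :=
  forall k u v, f (k *: u + v) = k * f u + f v.

Lemma linear_form0 (K : realFieldType) (V : lmodType K) (f : V -> K) :
  linear_form f -> f 0 = 0.
Proof. by move=> lf; have := lf (-1) 0 0; rewrite scaler0 addr0; lra. Qed.

Lemma linear_formZ (K : realFieldType) (V : lmodType K) (f : V -> K) k x :
  linear_form f -> f (k *: x) = k * f x.
Proof. by move=> lf; have := lf k x 0; rewrite addr0 (linear_form0 lf) addr0. Qed.

(* Bartl's induction on the number of forms. *)
Lemma farkas (K : realFieldType) (V : lmodType K) (J : finType)
    (a : J -> V -> K) (b : V -> K) :
  (forall j, linear_form (a j)) -> linear_form b ->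
  (exists x, (forall j, a j x <= 0) /\ 0 < b x) \/
  (exists l : J -> K, (forall j, 0 <= l j) /\
     forall x, b x = \sum_j l j * a j x).
Proof.
move=> la lb.
suff H (A : {set J}) : forall (a : J -> V -> K) (b : V -> K),
  (forall j, linear_form (a j)) -> linear_form b ->
  (exists x, (forall j, j \in A -> a j x <= 0) /\ 0 < b x) \/
  (exists l : J -> K, (forall j, 0 <= l j) /\
     forall x, b x = \sum_(j in A) l j * a j x).
  have [[x [xa xb]]|[l [l0 lE]]] := H [set: J] a b la lb.
    by left; exists x; split => // j; apply: xa; rewrite inE.
  by right; exists l; split => // x; rewrite lE; apply: eq_bigl => j; rewrite inE.
move: {2}#|A| (erefl #|A|) => m; elim: m A => [|m IH] A cA {la lb}a {}b la lb.
  have -> : A = finset.set0 by apply/eqP; rewrite -cards_eq0 cA.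
  have [[x bx]|nb] := pselect (exists x, b x != 0).
    left; exists (b x *: x); split=> [j|]; first by rewrite inE.
    by rewrite linear_formZ// -expr2 lt_def sqrf_eq0 bx sqr_ge0.
  right; exists (fun=> 0); split => // x; rewrite big_set0.
  by apply/eqP; apply: contra_notT nb => ?; exists x.
have [j0 j0A] : exists j, j \in A by apply/finset.set0Pn; rewrite -cards_eq0 cA.
have cA' : #|A :\ j0| = m by move: cA; rewrite (cardsD1 j0) j0A => -[].
have [[x [xa xb]]|[l [l0 lE]]] := IH _ cA' a b la lb; last first.
  right; exists (fun j => if j == j0 then 0 else l j); split => [j|x].
    by case: ifP.
  rewrite (big_setD1 j0)//= eqxx mul0r add0r lE; apply: eq_bigr => j.
  by rewrite !inE => /andP[/negbTE ->].
have [ajx|ajx] := leP (a j0 x) 0.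
  left; exists x; split => // j jA; have [->//|jj0] := eqVneq j j0.
  by apply: xa; rewrite !inE jj0.
wlog a1 : x xa xb {ajx} / a j0 x = 1.
  move=> /(_ ((a j0 x)^-1 *: x)); apply.
  - by move=> j jA; rewrite linear_formZ// mulr_ge0_le0 ?invr_ge0 ?xa// ltW.
  - by rewrite linear_formZ// mulr_gt0// invr_gt0.
  - by rewrite linear_formZ// mulVf// gt_eqF.
(* These are the forms composed with the projection [y - a j0 y *: x] onto the kernel of [a j0]
   along [x]. *)
pose a' j y := a j y - a j x * a j0 y; pose b' y := b y - b x * a j0 y.
have la' j : linear_form (a' j) by move=> k u v; rewrite /a' !la; ring.
have lb' : linear_form b' by move=> k u v; rewrite /b' la lb; ring.
have [[y [ya yb]]|[l [l0 lE]]] := IH _ cA' a' b' la' lb'.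
  left; exists (- a j0 y *: x + y); split => [j jA|].
    rewrite la; have [->|jj0] := eqVneq j j0; first by rewrite a1; lra.
    by have := ya j; rewrite !inE jj0 => /(_ jA); rewrite /a'; lra.
  by rewrite lb; move: yb; rewrite /b'; lra.
(* [c] is the multiplier of [a j0] forced by evaluation at [x]. It is nonnegative because [0 < b x]
   while the other forms are nonpositive at [x]. *)
right; pose c := b x - \sum_(j in A :\ j0) l j * a j x.
exists (fun j => if j == j0 then c else l j); split => [j|y].
  case: ifP => // _; rewrite subr_ge0 (le_trans _ (ltW xb))// sumr_le0// => i iA.
  by rewrite mulr_ge0_le0// xa.
rewrite (big_setD1 j0)//= eqxx.
have -> : \sum_(i in A :\ j0) (if i == j0 then c else l i) * a i y =
   \sum_(i in A :\ j0) (l i * a' i y + l i * a i x * a j0 y).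
  apply: eq_bigr => j; rewrite !inE => /andP[/negbTE -> _].
  by rewrite /a'; ring.
rewrite big_split /= -lE -mulr_suml /b' /c; ring.
Qed.

Definition dot (K : realFieldType) d (u x : 'rV[K]_d) : K := \sum_k u 0 k * x 0 k.

Lemma dotC (K : realFieldType) d (u x : 'rV[K]_d) : dot u x = dot x u.
Proof. by apply: eq_bigr => k _; rewrite mulrC. Qed.

Lemma linear_dot (K : realFieldType) d (x : 'rV[K]_d) : linear_form (dot x).
Proof.
move=> k u v; rewrite /dot mulr_sumr -big_split; apply: eq_bigr => i _ /=.
by rewrite !mxE; ring.
Qed.

Lemma linear_form_sum (K : realFieldType) (V : lmodType K) (f : V -> K)
    (I : Type) (r : seq I) (P : pred I) (c : I -> K) (x : I -> V) : linear_form f ->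
  f (\sum_(i <- r | P i) c i *: x i) = \sum_(i <- r | P i) c i * f (x i).
Proof.
move=> lf; elim/big_rec2: _ => [|i y1 y2 _ <-]; first exact: linear_form0.
by rewrite lf.
Qed.

Lemma dot0l (K : realFieldType) d (x : 'rV[K]_d) : dot 0 x = 0.
Proof. by rewrite dotC (linear_form0 (linear_dot x)). Qed.

Lemma dot0r (K : realFieldType) d (x : 'rV[K]_d) : dot x 0 = 0.
Proof. exact: linear_form0 (linear_dot x). Qed.

Lemma dotZl (K : realFieldType) d (u x : 'rV[K]_d) k : dot (k *: u) x = k * dot u x.
Proof. by rewrite dotC (linear_formZ _ _ (linear_dot x)) dotC. Qed.

Lemma dot_suml (K : realFieldType) d (I : Type) (r : seq I) (P : pred I)
    (c : I -> K) (u : I -> 'rV[K]_d) x :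
  dot (\sum_(i <- r | P i) c i *: u i) x = \sum_(i <- r | P i) c i * dot (u i) x.
Proof.
rewrite dotC linear_form_sum; last exact: linear_dot.
by under eq_bigr do rewrite dotC.
Qed.

Lemma dot_delta (K : realFieldType) d (u : 'rV[K]_d) k c :
  dot u (c *: delta_mx 0 k) = c * u 0 k.
Proof.
rewrite /dot (bigD1 k)//= big1 ?addr0 => [|l lk]; rewrite !mxE !eqxx/=.
  by rewrite mulr1 mulrC.
by rewrite (negbTE lk) !mulr0.
Qed.

Definition in_conv (K : realFieldType) d (Y : finType) (X : Y -> 'rV[K]_d) x :=
  exists w : Y -> K, [/\ forall y, 0 <= w y, \sum_y w y = 1 & x = \sum_y w y *: X y].

(** Duality: the polar of an intersection of polytopes is the convex hull of the union of their
    polars. The second hypothesis places [0] in the interior of each polytope, so that a functional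
    of weight zero must vanish. *)
Lemma polar_cap (K : realFieldType) d (I Y : finType) (i0 : I) (y0 : Y)
    (X : I -> Y -> 'rV[K]_d) (u : 'rV[K]_d) :
  (forall i, X i y0 = 0) ->
  (forall i g, (forall y, dot g (X i y) <= 0) -> g = 0) ->
  (forall x, (forall i, in_conv (X i) x) -> dot u x <= 1) ->
  exists (t : I -> K) (g : I -> 'rV[K]_d),
    [/\ forall i, 0 <= t i, \sum_i t i <= 1,
        forall i y, dot (g i) (X i y) <= 1 & u = \sum_i t i *: g i].
Proof.
move=> X0 Xspan uC.
(* The unknowns are (t_i *: g_i), (t_i) and a homogenizing scalar that Farkas' lemma makes
   positive; an infeasibility certificate is a point of the intersection violating [u <= 1]. *)
pose V := ({ffun I -> 'rV[K]_d} * {ffun I -> K^o} * K^o)%type.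
pose J := (I * Y + 'I_d * bool + unit)%type.
pose a (j : J) (v : V) : K := match j with
  | inl (inl (i, y)) => dot (v.1.1 i) (X i y) - v.1.2 i
  | inl (inr (k, s)) => (-1) ^+ s * (\sum_i v.1.1 i 0 k - v.2 * u 0 k)
  | inr _ => \sum_i v.1.2 i - v.2 end.
have la j : linear_form (a j).
  case: j => [[[i y]|[k s]]|t] c v w /=.
  - by rewrite !ffunE dotC linear_dot ![dot (X _ _) _]dotC/= /GRing.scale/=; ring.
  - rewrite (_ : \sum_i _ = c * (\sum_i v.1.1 i 0 k) + \sum_i w.1.1 i 0 k).
      by rewrite /GRing.scale/=; ring.
    rewrite mulr_sumr -big_split; apply: eq_bigr => i _ /=.
    by rewrite !ffunE !mxE.
  - rewrite (_ : \sum_i _ = c * (\sum_i v.1.2 i) + \sum_i w.1.2 i).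
      by rewrite /GRing.scale/=; ring.
    by rewrite mulr_sumr -big_split; apply: eq_bigr => i _ /=; rewrite !ffunE.
have lb : linear_form (fun v : V => v.2 : K) by move=> k v w.
have [[[[G t] s]] [/= aG s0]|[l [l0 lE]]] := farkas la lb.
  have Gt i y : dot (G i) (X i y) <= t i by have := aG (inl (inl (i, y))); rewrite /= subr_le0.
  have GE : \sum_i G i = s *: u.
    apply/rowP => k; rewrite summxE mxE; apply/eqP; rewrite -subr_eq0 eq_le.
    have := aG (inl (inr (k, false))); have := aG (inl (inr (k, true))) => /=.
    by rewrite expr0 expr1 mulN1r oppr_le0 mul1r => -> ->.
  have tE : \sum_i t i <= s by have := aG (inr tt); rewrite /= subr_le0.
  have t0 i : 0 <= t i by have := Gt i y0; rewrite X0 dot0r.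
  have G0 i : t i = 0 -> G i = 0.
    by move=> ti; apply: (Xspan i) => y; rewrite -ti.
  exists (fun i => t i / s), (fun i => (t i)^-1 *: G i); split.
  - by move=> i; rewrite divr_ge0// ltW.
  - by rewrite -mulr_suml ler_pdivrMr// mul1r.
  - move=> i y; rewrite dotZl; have [ti|ti] := eqVneq (t i) 0.
      by rewrite G0// dot0l mulr0.
    by rewrite mulrC ler_pdivrMr ?mul1r// lt_def ti t0.
  - rewrite -[LHS](scalerK (lt0r_neq0 s0)) -GE scaler_sumr; apply: eq_bigr => i _.
    rewrite scalerA; have [ti|ti] := eqVneq (t i) 0.
      by rewrite G0// !scaler0.
    by rewrite mulrAC mulfV// mul1r.
(* [mu] is the multiplier of [\sum_i t i <= s], and [x] the net multiplier of the two inequalities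
   that encode [\sum_i G i = s *: u]. *)
pose mu := l (inr tt).
pose x : 'rV[K]_d := \row_k (l (inl (inr (k, true))) - l (inl (inr (k, false)))).
have aE (G : I -> 'rV[K]_d) (t : I -> K) (s : K) :
    s = \sum_i \sum_y l (inl (inl (i, y))) * (dot (G i) (X i y) - t i) -
     (\sum_k x 0 k * (\sum_i G i 0 k - s * u 0 k)) + mu * (\sum_i t i - s).
  have := lE ([ffun i => G i], [ffun i => t i], s); rewrite /= => sE; rewrite [LHS]sE
  2!big_sumType/= {sE}; congr (_ + _ + _).
  - by rewrite pair_bigA; apply: eq_bigr => -[i y] _ /=; rewrite !ffunE.
  - rewrite -sumrN; transitivity (\sum_k \sum_b l (inl (inr (k, b))) *
        ((-1) ^+ b * (\sum_i G i 0 k - s * u 0 k))).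
      rewrite pair_bigA; apply: eq_bigr => -[k b] _ /=.
      by under eq_bigr do rewrite ffunE.
    by apply: eq_bigr => k _; rewrite big_bool/= mxE expr0 expr1; ring.
  - by rewrite (big_pred1 tt) => [|[]//]; under eq_bigr do rewrite ffunE.
(* [aE] is an identity in [G], [t] and [s]; testing it on families supported at one index [i]
   expresses [x] and [mu] by the multipliers of that [i] alone. *)
have xE i : x = \sum_y l (inl (inl (i, y))) *: X i y.
  suff H z : dot x z = dot (\sum_y l (inl (inl (i, y))) *: X i y) z.
    by apply/rowP => k; have := H (1 *: delta_mx 0 k); rewrite !dot_delta !mul1r.
  have := aE (fun i' => if i' == i then z else 0) (fun=> 0) 0.
  rewrite big1_eq subr0 mulr0 addr0 => /esym/eqP; rewrite subr_eq0 => /eqP.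
  rewrite (bigD1 i)//= [X in _ + X]big1 ?addr0 => [|i' /negbTE ->]; last first.
    by rewrite big1// => y _; rewrite dot0l subr0 mulr0.
  rewrite eqxx dot_suml => H.
  transitivity (\sum_k x 0 k * (\sum_i0 (if i0 == i then z else 0) 0 k - 0 * u 0 k)).
    apply: eq_bigr => k _; rewrite mul0r subr0 (bigD1 i)//= eqxx big1 ?addr0//.
    by move=> i' /negbTE ->; rewrite mxE.
  by rewrite -H; apply: eq_bigr => y _; rewrite subr0 dotC.
have muE i : mu = \sum_y l (inl (inl (i, y))).
  have := aE (fun=> 0) (fun i' => (i' == i)%:R) 0.
  have -> : \sum_i0 (i0 == i)%:R = 1 :> K.
    by rewrite (bigD1 i)//= eqxx big1 ?addr0// => i' /negbTE ->.
  have -> : \sum_k x 0 k * (\sum_(i0 : I) (0 : 'rV[K]_d) 0 k - 0 * u 0 k) = 0.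
    by apply: big1 => k _; rewrite mul0r subr0 big1 ?mulr0// => i' _; rewrite mxE.
  have -> : \sum_i0 \sum_y l (inl (inl (i0, y))) * (dot 0 (X i0 y) - (i0 == i)%:R) =
      - \sum_y l (inl (inl (i, y))).
    rewrite (bigD1 i)//= [X in _ + X]big1 ?addr0 => [|i' /negbTE ->]; last first.
      by rewrite big1// => y _; rewrite dot0l subr0 mulr0.
    by rewrite -sumrN eqxx; apply: eq_bigr => y _; rewrite dot0l sub0r mulrN1.
  by lra.
have ux : dot u x = 1 + mu.
  have := aE (fun=> 0) (fun=> 0) 1.
  have -> : \sum_i \sum_y l (inl (inl (i, y))) * (dot 0 (X i y) - 0) = 0.
    by apply: big1 => i _; apply: big1 => y _; rewrite dot0l subr0 mulr0.
  have -> : \sum_k x 0 k * (\sum_(i : I) (0 : 'rV[K]_d) 0 k - 1 * u 0 k) = - dot u x.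
    rewrite /dot -sumrN; apply: eq_bigr => k _.
    by rewrite big1 => [|i _]; [ring | rewrite mxE].
  by rewrite big1_eq; lra.
have mu0 : 0 <= mu by exact: l0.
(* If [mu] vanishes, so does [x], against [dot u x = 1 + mu]. Otherwise [mu^-1 *: x] lies in every
   hull, and [u] takes the value [1 + mu^-1] there. *)
have [mu00|mun0] := eqVneq mu 0.
  have : dot u x = 0.
    rewrite (xE i0) big1 ?dot0r// => y _.
    suff -> : l (inl (inl (i0, y))) = 0 by rewrite scale0r.
    by move: mu00; rewrite (muE i0) => /psumr_eq0P; apply.
  by rewrite ux; lra.
have mupos : 0 < mu by rewrite lt_def mun0.
have := uC (mu^-1 *: x); rewrite dotC dotZl dotC ux => H.
suff : mu^-1 * (1 + mu) <= 1 by rewrite mulrDr mulr1 mulVf// gerDr leNgt invr_gt0 mupos.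
apply: H => i; exists (fun y => mu^-1 * l (inl (inl (i, y)))); split.
- by move=> y; rewrite mulr_ge0// invr_ge0.
- by rewrite -mulr_sumr -muE mulVf.
- by rewrite (xE i) scaler_sumr; apply: eq_bigr => y _; rewrite scalerA.
Qed.

Lemma linear_det_setrow (K : realFieldType) d (M : 'M[K]_d) k :
  linear_form (fun v => \det (setrow M k v)).
Proof. by move=> c u v; rewrite !det_setrow mulmxDl -scalemxAl !mxE. Qed.

Lemma setrow_id (K : fieldType) d (M : 'M[K]_d) k : setrow M k (row k M) = M.
Proof. by apply/matrixP => i j; rewrite !mxE; case: eqP => // ->. Qed.

(* The determinant is linear in each row, so rows that are convex combinations can be
   replaced one at a time by one of the combined vectors. *)
Lemma det_row_choice (K : realFieldType) d (I : finType) (i0 : I)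
    (Q : I -> 'rV[K]_d -> Prop) (v : 'M[K]_d) :
  (forall k, exists (t : I -> K) (g : I -> 'rV[K]_d),
    [/\ forall i, 0 <= t i, \sum_i t i <= 1, forall i, Q i (g i)
      & row k v = \sum_i t i *: g i]) ->
  exists (M : 'M[K]_d) (c : 'I_d -> I),
    (forall k, Q (c k) (row k M)) /\ `|\det v| <= `|\det M|.
Proof.
move=> vQ.
suff H n : (n <= d)%N -> exists (M : 'M[K]_d) (c : 'I_d -> I),
    [/\ forall k : 'I_d, (k < n)%N -> Q (c k) (row k M),
        forall k : 'I_d, (n <= k)%N -> row k M = row k v & `|\det v| <= `|\det M|].
  have [M [c [h1 _ h2]]] := H d (leqnn _); exists M, c; split=> // k.
  exact: h1 (ltn_ord k).
elim: n => [_|n IH nd]; first by exists v, (fun=> i0).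
have [M [c [Mlt Mge detM]]] := IH (ltnW nd).
pose k := Ordinal nd; have [t [g [t0 t1 Qg vE]]] := vQ k.
pose L x := \det (setrow M k x).
have lL : linear_form L by exact: linear_det_setrow.
case: (@arg_maxP _ _ _ i0 predT (fun i => `|L (g i)|) isT) => i _ imax.
exists (setrow M k (g i)), (fun l => if l == k then i else c l); split.
- move=> l ln; rewrite row_setrow; case: eqP => [//|/eqP lk].
  by apply: Mlt; rewrite ltn_neqAle -ltnS ln andbT; exact: lk.
- move=> l ln; rewrite row_setrow ifN; first by rewrite Mge// ltnW.
  by rewrite -val_eqE neq_ltn ln orbT.
rewrite (le_trans detM)// -[X in `|\det X| <= _](setrow_id M k) Mge// vE -/(L _).
rewrite linear_form_sum// (le_trans (ler_norm_sum _ _ _))//.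
apply: (@le_trans _ _ (\sum_j t j * `|L (g i)|)).
  by apply: ler_sum => j _; rewrite normrM (ger0_norm (t0 j)) ler_wpM2l//; exact: imax.
by rewrite -mulr_suml ler_piMl.
Qed.

Lemma linear_dependency (K : realFieldType) d (I : finType) (S : {set I}) (w : I -> 'rV[K]_d) :
  (d < #|S|)%N -> exists c : I -> K,
    [/\ forall i, i \notin S -> c i = 0, exists i, c i != 0 & \sum_i c i *: w i = 0].
Proof.
move=> dS; pose W : 'M[K]_(#|S|, d) := \matrix_(j, l) w (enum_val j) 0 l.
have : kermx W != 0.
  rewrite -mxrank_eq0 mxrank_ker -lt0n subn_gt0.
  exact: leq_ltn_trans (rank_leq_col W) dS.
case/rowV0Pn => v /sub_kermxP vW v0.
pose c i := \sum_j v 0 j * (enum_val j == i :> I)%:R.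
have cE j : c (enum_val j) = v 0 j.
  rewrite /c (bigD1 j)//= eqxx mulr1 big1 ?addr0// => j' j'j.
  by rewrite (inj_eq enum_val_inj) (negbTE j'j) mulr0.
exists c; split.
- move=> i iS; rewrite /c big1// => j _; case: eqP => [ij|_]; last by rewrite mulr0.
  by move: iS; rewrite -ij enum_valP.
- case/rV0Pn: v0 => j vj; exists (enum_val j); by rewrite cE.
- rewrite /c; transitivity (v *m W); last by [].
  apply/rowP => l; rewrite summxE mxE.
  under eq_bigr do rewrite mxE mulr_suml.
  rewrite exchange_big/=; apply: eq_bigr => j _.
  rewrite (bigD1 (enum_val j))//= eqxx mulr1 big1 ?addr0 ?mxE// => i ij.
  by rewrite eq_sym (negbTE ij) mulr0 mul0r.
Qed.

(* Along a linear dependency, oriented so as not to increase the total weight, one can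
   move until a coefficient vanishes. *)
Lemma caratheodory (K : realFieldType) d (I : finType) (w : I -> 'rV[K]_d) (b : I -> K) :
  (forall i, 0 <= b i) -> exists b' : I -> K,
  [/\ forall i, 0 <= b' i, \sum_i b' i <= \sum_i b i,
      \sum_i b' i *: w i = \sum_i b i *: w i & (#|[set i | b' i != 0%R]| <= d)%N].
Proof.
have [m] := ubnP #|[set i | b i != 0]|; elim: m b => // m IH b bm b0.
have [|dS] := leqP #|[set i | b i != 0]| d; first by exists b.
have [c [cS [i1 ci1] cw]] := linear_dependency w dS.
wlog c0 : c cS ci1 cw / 0 <= \sum_i c i.
  move=> H; have [|c0] := leP 0 (\sum_i c i); first exact: (H c).
  apply: (H (fun i => - c i)) => [i iS|||].
  - by rewrite cS// oppr0.
  - by rewrite oppr_eq0.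
  - by under eq_bigr do rewrite scaleNr; rewrite sumrN cw oppr0.
  - by rewrite sumrN oppr_ge0 ltW.
have [i2 ci2] : exists i, 0 < c i.
  apply: contrapT => nc.
  have cle i : c i <= 0 by rewrite leNgt; apply/negP => ci; apply: nc; exists i.
  have : \sum_i - c i == 0.
    rewrite sumrN oppr_eq0 eq_le c0 andbT; exact: sumr_le0.
  rewrite psumr_eq0 => [/allP/(_ i1)|i _]; last by rewrite oppr_ge0.
  by rewrite mem_index_enum oppr_eq0 (negbTE ci1) => /(_ isT).
case: (@arg_minP _ _ _ i2 (fun i => 0 < c i) (fun i => b i / c i) ci2) => i ci imin.
(* [r] is the largest step that keeps all coefficients nonnegative; the one at [i] becomes zero. *)
pose r := b i / c i; have r0 : 0 <= r by rewrite divr_ge0// ltW.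
pose b1 j := b j - r * c j.
have [||b' [b'0 b'1 b'2 b'3]] := IH b1.
- apply: (@leq_trans #|[set i | b i != 0]|) => //; apply: proper_card.
  apply/properP; split.
    apply/fintype.subsetP => j; rewrite !inE /b1; apply: contra => /eqP bj.
    by rewrite cS ?inE bj ?eqxx// mulr0 subr0.
  exists i; rewrite !inE /b1 /r.
    apply/negP => /eqP bi; move: ci; rewrite cS ?ltxx// inE bi eqxx//.
  by rewrite divfK ?subrr ?eqxx// gt_eqF.
- move=> j; rewrite subr_ge0; have [cj|cj] := ltP 0 (c j).
    by rewrite -ler_pdivlMr// imin.
  by rewrite (le_trans _ (b0 j))// mulr_ge0_le0.
exists b'; split => //.
- rewrite (le_trans b'1)// sumrB gerBl -mulr_sumr mulr_ge0//.
- rewrite b'2; under eq_bigr do rewrite scalerBl -scalerA.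
  by rewrite sumrB -scaler_sumr cw scaler0 subr0.
Qed.

(* A simplex is given by a vertex [p] and the edge vectors from [p], the rows of [M]; its
   volume is |det M| / d!. *)
Definition vertex (K : realFieldType) d (p : 'rV[K]_d) (M : 'M[K]_d) (o : option 'I_d) :=
  if o is Some k then p + row k M else p.

(* Closed under finite convex combinations; for subsets of R^d this is implied by [convex_set]
   (see [convex_setP]). *)
Definition is_convex (K : realFieldType) d (A : 'rV[K]_d -> Prop) :=
  forall (Y : finType) (X : Y -> 'rV[K]_d) x, (forall y, A (X y)) -> in_conv X x -> A x.

Definition simplex_in (K : realFieldType) d (A : 'rV[K]_d -> Prop) p M :=
  forall o, A (vertex p M o).

Lemma is_convex_mid (K : realFieldType) d (A : 'rV[K]_d -> Prop) x y :
  is_convex A -> A x -> A y -> A (2^-1 *: (x + y)).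
Proof.
move=> cA Ax Ay; apply: (cA bool (fun b => if b then x else y)); first by case.
exists (fun=> 2^-1); split; first by move=> _; rewrite invr_ge0.
- by rewrite big_bool/=; field.
- by rewrite big_bool/= scalerDr.
Qed.

Lemma norm_dot_le (K : realFieldType) d (u x : 'rV[K]_d) a b :
  (forall k, `|u 0 k| <= a) -> (forall k, `|x 0 k| <= b) -> `|dot u x| <= d%:R * (a * b).
Proof.
move=> ua xb; rewrite (le_trans (ler_norm_sum _ _ _))//.
rewrite -[X in X%:R](card_ord d) mulr_natl -sumr_const; apply: ler_sum => k _.
by rewrite normrM ler_pM.
Qed.

(** [3 ^+ d] inverts the lower bound on the determinant of the functionals. The rest is the Leibniz
    bound for a matrix of differences of their values, which are at most
    [3 * d%:R ^+ 2 / beta + d%:R]. *)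
Definition helly_cst (K : realFieldType) d (beta : K) : K :=
  3 ^+ d * ((d`!)%:R * (3 * d%:R ^+ 2 / beta + d%:R) ^+ d).

(** * The quantitative Helly theorem for simplices *)

Lemma ball_helly (K : realFieldType) d (I : finType) (i0 : I)
    (D : I -> 'rV[K]_d -> Prop) (s beta : K) : (0 < d)%N -> 0 < beta ->
  (forall i, is_convex (D i)) ->
  (forall i k, D i (beta *: delta_mx 0 k) /\ D i (- beta *: delta_mx 0 k)) ->
  (forall x, (forall i, D i x) -> forall k, `|x 0 k| <= 3) ->
  (forall J : {set I}, (#|J| <= 2 * d)%N -> exists p M,
     (forall i, i \in J -> simplex_in (D i) p M) /\ s <= `|\det M|) ->
  s <= helly_cst d beta.
Proof.
move=> d0 beta0 cD Dbeta D3 DJ.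
have /choice[f fP] : forall J : {set I}, exists pM : 'rV[K]_d * 'M[K]_d,
    (#|J| <= 2 * d)%N -> (forall i, i \in J -> simplex_in (D i) pM.1 pM.2) /\
      s <= `|\det pM.2|.
  move=> J; have [Jd|_] := leqP #|J| (2 * d); last by exists (0, 0).
  by have [p [M ?]] := DJ _ Jd; exists (p, M).
(* Each [D i] is replaced by a polytope: the hull of [0], the cross-polytope and the vertices of all
   selected simplices [f J] with [i \in J]. The other indices give the harmless point [0]. *)
pose Y := option ('I_d * bool + {set I} * option 'I_d).
pose X i (y : Y) : 'rV[K]_d := match y with
  | None => 0
  | Some (inl (k, b)) => (if b then beta else - beta) *: delta_mx 0 k
  | Some (inr (J, o)) => if (i \in J) && (#|J| <= 2 * d)%N then
      vertex (f J).1 (f J).2 o else 0 end.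
have D0 i : D i 0.
  have [h1 h2] := Dbeta i (Ordinal d0); have := is_convex_mid (cD i) h1 h2.
  by rewrite scaleNr subrr scaler0.
have DX i y : D i (X i y).
  case: y => [[[k []]|[J o]]|] /=; [by case: (Dbeta i k)..| |by []].
  by case: ifP => // /andP[iJ Jd]; have [h _] := fP _ Jd; exact: h.
have capX x : (forall i, in_conv (X i) x) -> forall k, `|x 0 k| <= 3.
  by move=> xC; apply: D3 => i; apply: (cD i) (xC i) => y.
have Xspan i g : (forall y, dot g (X i y) <= 0) -> g = 0.
  move=> gX; apply/rowP => k; rewrite mxE; apply/eqP; rewrite eq_le.
  have := gX (Some (inl (k, true))); have := gX (Some (inl (k, false))).
  by rewrite /= !dot_delta mulNr oppr_le0 pmulr_rge0// pmulr_rle0// => -> ->.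
pose Q i g := forall y, dot g (X i y) <= 1.
have QX i g k : Q i g -> `|g 0 k| <= beta^-1.
  move=> gX; have := gX (Some (inl (k, true))); have := gX (Some (inl (k, false))).
  rewrite /= !dot_delta => h1 h2.
  rewrite -[beta^-1]mul1r ler_pdivlMr// -{1}(ger0_norm (ltW beta0)) -normrM ler_norml.
  by apply/andP; split; lra.
have polar (u : 'rV[K]_d) : (forall x : 'rV[K]_d, (forall k, `|x 0 k| <= 3) -> dot u x <= 1) ->
  exists (t : I -> K) (g : I -> 'rV[K]_d),
    [/\ forall i, 0 <= t i, \sum_i t i <= 1, forall i, Q i (g i)
      & u = \sum_i t i *: g i].
  move=> u3; apply: (polar_cap i0 (y0 := None)) => // x xC.
  exact/u3/capX.
have [|G [c [Gc detG]]] := det_row_choice i0 (Q := Q) (v := (3^-1)%:M).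
  move=> k; apply: polar => x x3.
  rewrite (_ : row k _ = 3^-1 *: delta_mx 0 k).
    rewrite dotC dot_delta mulrC ler_pdivrMr// mul1r.
    by rewrite (le_trans (ler_norm _)).
  by apply/rowP => l; rewrite !mxE !eqxx/= eq_sym mulr_natr.
rewrite det_scalar ger0_norm ?exprn_ge0 ?invr_ge0// in detG.
pose z := \sum_k row k G.
have dotz x : dot z x = \sum_k dot (row k G) x.
  rewrite (_ : z = \sum_k 1 *: row k G); last by under eq_bigr do rewrite scale1r.
  by rewrite dot_suml; under eq_bigr do rewrite mul1r.
have dpos : 0 < d%:R :> K by rewrite ltr0n.
(* The coordinates of [z] are at most [d%:R / beta], so [m] bounds [z] on the cube of radius 3 and
   [- m^-1 *: z] meets the hypothesis of [polar]. *)
pose m : K := 3 * d%:R ^+ 2 / beta.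
have m0 : 0 < m by rewrite divr_gt0// mulr_gt0// exprn_gt0.
have [|t [g [t0 t1 Qg zE]]] := polar (- m^-1 *: z).
  move=> x x3; rewrite dotZl mulNr (le_trans (ler_norm _))// normrN normrM.
  rewrite normfV (gtr0_norm m0) mulrC ler_pdivrMr// mul1r.
  have zk k : `|z 0 k| <= d%:R / beta.
    rewrite summxE (le_trans (ler_norm_sum _ _ _))// mulr_natl.
    rewrite -[X in _ *+ X](card_ord d) -sumr_const; apply: ler_sum => l _.
    exact: QX (Gc l).
  rewrite (le_trans (norm_dot_le zk x3))// (_ : _ * _ = m)//.
  by rewrite /m; field; rewrite gt_eqF.
have [t' [t'0 t't t'g t'd]] := caratheodory g t0.
pose J := [set i | t' i != 0] :|: [set c k | k : 'I_d].
have Jd : (#|J| <= 2 * d)%N.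
  rewrite (leq_trans (leq_card_setU _ _).1)// mul2n -addnn leq_add//.
  by rewrite (leq_trans (leq_imset_card _ _))// card_ord.
have [fJ sJ] := fP _ Jd.
set p := (f J).1 in fJ; set M := (f J).2 in fJ sJ.
(* At a vertex the sum of the [d] functionals is at least [- m], and all but one of them contribute
   at most 1 each; this bounds the remaining one from below. *)
have yP o k : - (m + d%:R - 1) <= dot (row k G) (vertex p M o) <= 1.
  have y1 l : dot (row l G) (vertex p M o) <= 1.
    have := Gc l (Some (inr (J, o))); rewrite /X Jd andbT ifT//.
    by rewrite inE; apply/orP; right; apply: imset_f.
  rewrite y1 andbT.
  have : - m <= dot z (vertex p M o).
    have -> : z = - m *: (- m^-1 *: z).
      by rewrite scalerA mulrNN mulfV ?scale1r// gt_eqF.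
    rewrite zE -t'g dotZl dot_suml mulNr lerNl opprK -[leRHS]mulr1 ler_wpM2l ?(ltW m0)//.
    rewrite (le_trans _ t1)// (le_trans _ t't)//; apply: ler_sum => i _.
    have [->|ti] := eqVneq (t' i) 0; first by rewrite mul0r.
    rewrite -[leRHS]mulr1 ler_wpM2l//.
    have := Qg i (Some (inr (J, o))); rewrite /X Jd andbT ifT//.
    by rewrite !inE ti.
  rewrite dotz (bigD1 k)//= => mz.
  have : \sum_(l | l != k) dot (row l G) (vertex p M o) <= d%:R - 1.
    rewrite (le_trans (ler_sum _ (G := fun=> 1) _))// sumr_const.
    rewrite cardC1 card_ord -subn1 natrB//.
  by move: mz; lra.
have detMG : `|\det (M *m G^T)| <= (d`!)%:R * (m + d%:R) ^+ d.
  apply: normr_det_le => k l.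
  have -> : (M *m G^T) k l = dot (row l G) (vertex p M (Some k)) - dot (row l G) (vertex p M None).
    rewrite /dot -sumrB mxE; apply: eq_bigr => j _ /=; rewrite !mxE; ring.
  have := yP (Some k) l; have := yP None l; rewrite ler_norml.
  by move=> /andP[? ?] /andP[? ?]; apply/andP; split; lra.
rewrite det_mulmx det_tr normrM in detMG.
rewrite (le_trans sJ)// /helly_cst -/m.
rewrite -[leLHS](mulfK (x := 3^-1 ^+ d)) ?expf_neq0 ?invr_neq0 ?pnatr_eq0//.
rewrite exprVn invrK mulrC ler_wpM2l ?exprn_ge0//.
rewrite (le_trans _ detMG)// ler_wpM2l//.
by rewrite -exprVn.
Qed.

Lemma sum_option (K : nmodType) d (F : option 'I_d -> K) :
  \sum_o F o = F None + \sum_k F (Some k).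
Proof.
rewrite (bigD1 None)//=; congr (_ + _).
rewrite (reindex_omap Some id)/=; last by case.
by apply: eq_bigl => k; rewrite eqxx.
Qed.

Lemma simplex_conv (K : realFieldType) d (A : 'rV[K]_d -> Prop) p M (a : 'rV[K]_d) :
  is_convex A -> simplex_in A p M -> (forall k, 0 <= a 0 k) -> \sum_k a 0 k <= 1 ->
  A (p + a *m M).
Proof.
move=> cA pM a0 a1; apply: (cA _ (vertex p M)) => //.
exists (fun o => if o is Some k then a 0 k else 1 - \sum_k a 0 k); split.
- by case=> [k|]; rewrite ?subr_ge0.
- by rewrite sum_option/= subrK.
- rewrite sum_option/= scalerBl scale1r -addrA; congr (_ + _).
  rewrite [in RHS](eq_bigr (fun k => a 0 k *: p + a 0 k *: row k M)); last first.
    by move=> k _; rewrite scalerDr.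
  by rewrite big_split/= -scaler_suml addKr mulmx_sum_row.
Qed.

Lemma is_convex_affine (K : realFieldType) d (A : 'rV[K]_d -> Prop) (p : 'rV[K]_d) (M : 'M[K]_d) :
  is_convex A -> is_convex (fun x => A (p + x *m M)).
Proof.
move=> cA Y X x XA [w [w0 w1 xE]]; apply: (cA _ _ _ XA); exists w; split => //.
rewrite xE mulmx_suml; under [in RHS]eq_bigr do rewrite scalerDr.
by rewrite big_split/= -scaler_suml w1 scale1r; under eq_bigr do rewrite -scalemxAl.
Qed.

(** Replacing vertex [k] by [x] gives another simplex in [A], whose determinant is the [k]-th
    coordinate of [x] times [\det M]. *)
Lemma near_max_coord (K : realFieldType) d (A : 'rV[K]_d -> Prop) p M kappa :
  simplex_in A p M -> \det M != 0 ->
  (forall q N, simplex_in A q N -> `|\det N| <= kappa * `|\det M|) ->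
  forall x, A x -> forall k, `|((x - p) *m invmx M) 0 k| <= kappa.
Proof.
move=> pM M0 maxM x Ax k; set a := _ *m _.
have aM : a *m M = x - p by rewrite mulmxKV// unitmxE unitfE.
rewrite -(ler_pM2r (x := `|\det M|)) ?normr_gt0// -normrM -(det_setrow_mulmx M k a) aM.
apply: (maxM p); case=> [l|] /=; last exact: (pM None).
rewrite row_setrow; case: eqP => _; last exact: (pM (Some l)).
by rewrite addrC subrK.
Qed.

Lemma vertex_affine (K : realFieldType) d (p q : 'rV[K]_d) (M N : 'M[K]_d) o :
  vertex (p + q *m M) (N *m M) o = p + vertex q N o *m M.
Proof. by case: o => //= k; rewrite row_mul mulmxDl addrA. Qed.

Lemma helly_near_max (K : realFieldType) d (I : finType) (i0 : I)
    (D : I -> 'rV[K]_d -> Prop) (s : K) p M : (0 < d)%N ->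
  (forall i, is_convex (D i)) -> \det M != 0 ->
  (forall i, simplex_in (D i) p M) ->
  (forall q N, (forall i, simplex_in (D i) q N) -> `|\det N| <= 2 * `|\det M|) ->
  (forall J : {set I}, (#|J| <= 2 * d)%N -> exists q N,
     (forall i, i \in J -> simplex_in (D i) q N) /\ s <= `|\det N|) ->
  s <= helly_cst d (d.+1%:R^-1) * `|\det M|.
Proof.
move=> d0 cD M0 pM maxM DJ.
have Mpos : 0 < `|\det M| by rewrite normr_gt0.
have Mu : M \in unitmx by rewrite unitmxE unitfE.
pose beta : K := d.+1%:R^-1; have beta0 : 0 < beta by rewrite invr_gt0.
have betad : beta *+ d = 1 - beta.
  have : d.+1%:R * beta = 1 by rewrite mulfV ?pnatr_eq0.
  by rewrite -mulr_natl -natr1 mulrDl mul1r; lra.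
have beta1 : beta <= 1 by rewrite invf_le1 ?ler1n.
(* These are the coordinates of the barycenter. A move of [beta] along an axis keeps them
   nonnegative with sum at most 1, and recentering by [b] turns the coordinate bound 2 into 3. *)
pose b : 'rV[K]_d := const_mx beta.
rewrite -ler_pdivrMr// -/beta.
apply: (@ball_helly _ _ _ i0 (fun i x => D i (p + b *m M + x *m M))) => //.
- by move=> i; apply: is_convex_affine.
- have sumb c k : \sum_l (b + c *: delta_mx 0 k) 0 l = 1 - beta + c.
    under eq_bigr do rewrite !mxE.
    rewrite big_split/= sumr_const card_ord betad (bigD1 k)//= !eqxx mulr1.
    by rewrite big1 ?addr0// => l /negbTE ->; rewrite ?andbF mulr0.
  move=> i k; split; rewrite -addrA -mulmxDl; apply: simplex_conv => //.
  + by move=> l; rewrite !mxE; case: (_ && _) => /=; lra.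
  + by rewrite sumb; lra.
  + by move=> l; rewrite !mxE; case: (_ && _) => /=; lra.
  + by rewrite sumb; lra.
- move=> x Dx k.
  have := near_max_coord (A := fun x => forall i, D i x) (p := p) (kappa := 2) _ M0 _ Dx k.
  rewrite -[p + _ + _]addrA -mulmxDl addrAC subrr add0r mulmxK// => H.
  have : `|(b + x) 0 k| <= 2.
    by apply: H => [v i|q N qN]; [exact: pM|apply: (maxM q) => i o; exact: qN].
  by rewrite !mxE !ler_norml => /andP[h1 h2]; apply/andP; split; lra.
- move=> J Jd; have [q [N [qN sN]]] := DJ J Jd.
  exists ((q - p) *m invmx M - b), (N *m invmx M); split => [i iJ o|].
    rewrite -vertex_affine mulmxKV// mulmxBl mulmxKV//.
    rewrite (_ : p + _ + _ = q) ?qN//; first exact: qN.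
    by rewrite -[q - p - _]addrA -opprD subrKC.
  by rewrite det_mulmx det_inv normrM normfV ler_wpM2r// invr_ge0.
Qed.

(** * Charging *)

(** The supremum of the determinants need not be attained, so a factor 2 is given up. If the
    near-optimal simplex falls below [v], the given one exceeds it and is itself near-maximal. *)
Lemma near_max_simplex (K : realType) d (A : 'rV[K]_d -> Prop) (v B : K) : 0 < v ->
  (exists p M, simplex_in A p M /\ v <= `|\det M|) ->
  (forall p M, simplex_in A p M -> `|\det M| <= B) ->
  exists p M, [/\ simplex_in A p M, v <= `|\det M| &
    forall q N, simplex_in A q N -> `|\det N| <= 2 * `|\det M|].
Proof.
move=> v0 [p [M [pM vM]]] AB.
pose E : set K := [set x | exists q N, simplex_in A q N /\ x = `|\det N|]%classic.
have supE : has_sup E.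
  split; first by exists `|\det M|, p, M.
  by exists B => _ [q [N [qN ->]]]; exact: AB qN.
have EM : E `|\det M| by exists p, M.
have supv : v <= sup E by rewrite (le_trans vM)// ub_le_sup//; case: supE.
have [_ [q [N [qN ->]]] ltN] := sup_adherent (divr_gt0 (lt_le_trans v0 supv) (ltr0n K 2)) supE.
have half q' N' : simplex_in A q' N' -> `|\det N'| <= 2 * `|\det N|.
  move=> qN'; have : `|\det N'| <= sup E.
    by apply: ub_le_sup; [case: supE | exists q', N'].
  by move: ltN; lra.
have [vN|/ltW Nv] := leP v `|\det N|; first by exists q, N.
exists p, M; split => // q' N' /half; move: vM; lra.
Qed.

(** A bounded simplex that is thin in one coordinate direction has small determinant; read
    backwards, this bounds the height of a simplex from below. *)
Lemma normr_det_col_le (K : realFieldType) d (M : 'M[K]_d) k (e B : K) : 1 <= B ->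
  (forall i j, `|M i j| <= B) -> (forall i, `|M i k| <= e) ->
  `|\det M| <= e * (d%:R * ((d`!)%:R * B ^+ d)).
Proof.
move=> B1 MB Me; rewrite (expand_det_col _ k) (le_trans (ler_norm_sum _ _ _))//.
set Z := (d`!)%:R * _.
have -> : e * (d%:R * Z) = \sum_(i < d) e * Z.
  by rewrite sumr_const card_ord mulrCA mulr_natl.
apply: ler_sum => i _; rewrite normrM ler_pM//.
by have := normr_adj_le B1 MB k i; rewrite mxE.
Qed.

Lemma helly_cst_ge1 (K : realFieldType) d (beta : K) : (0 < d)%N -> 0 < beta ->
  1 <= helly_cst d beta.
Proof.
move=> d0 b0; have d1 : 1 <= d%:R :> K by rewrite ler1n.
rewrite /helly_cst -[leLHS]mul1r ler_pM// ?exprn_ege1 ?ler1n//.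
rewrite -[leLHS]mul1r ler_pM// ?ler1n ?fact_gt0// exprn_ege1//.
by rewrite (le_trans d1)// lerDr divr_ge0 ?(ltW b0)// mulr_ge0// exprn_ge0.
Qed.

Lemma vertexZ (K : realFieldType) d (p q : 'rV[K]_d) M k o :
  vertex (k *: (p + q)) (k *: M) o = k *: (vertex p M o + q).
Proof.
case: o => [l|] //=; rewrite -[k *: (p + q) + _]addrC.
by rewrite (_ : row l (k *: M) = k *: row l M) -?scalerDr ?addrA ?[_ + p]addrC//;
   apply/rowP => j; rewrite !mxE.
Qed.

Lemma simplex_det_le (K : realFieldType) d (A : 'rV[K]_d -> Prop) p M (B : K) :
  (forall x, A x -> forall k, `|x 0 k| <= B) -> simplex_in A p M ->
  forall k l, `|M k l| <= 2 * B.
Proof.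
move=> AB pM k l; have := AB _ (pM (Some k)) l; have := AB _ (pM None) l.
by rewrite /= !mxE !ler_norml => /andP[? ?] /andP[? ?]; apply/andP; split; lra.
Qed.

Lemma is_convex_halfspace (K : realFieldType) d k (t : K) :
  is_convex (fun x : 'rV[K]_d => x 0 k <= t).
Proof.
move=> Y X x Xt [w [w0 w1 ->]]; rewrite summxE -[leRHS]mul1r -w1 mulr_suml.
by apply: ler_sum => y _; rewrite mxE ler_wpM2l.
Qed.

(** The loss in Helly's theorem times the loss from halving a simplex. *)
Definition descent_cst (K : realFieldType) d : K := helly_cst d (d.+1%:R^-1) * 2 ^+ d.

Lemma descent_cst_gt0 (K : realFieldType) d : (0 < d)%N -> 0 < descent_cst K d.
Proof.
move=> d0; rewrite mulr_gt0 ?exprn_gt0//; apply: lt_le_trans ltr01 _.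
by apply: helly_cst_ge1; rewrite ?invr_gt0.
Qed.

(* Otherwise Helly shows that the part of the intersection of [S] below any admissible level
   [t] contains a simplex 2^d times larger than required; halving it towards its lowest
   vertex shows that [t - delta] is admissible, with [delta > 0] independent of [t]. *)
Lemma descent (K : realType) d (k0 : 'I_d) (I : finType) (S : {set I})
    (F : I -> 'rV[K]_d -> Prop) (Rb s1 : K) :
  #|S| = (2 * d)%N -> (forall i, is_convex (F i)) ->
  (forall i, i \in S -> forall x, F i x -> forall k, `|x 0 k| <= Rb) -> 0 < s1 ->
  (exists p M, simplex_in (fun x => forall i, i \in S -> F i x) p M /\ s1 <= `|\det M|) ->
  exists k t, [/\ k \in S,
    exists p M, simplex_in (fun x => x 0 k0 <= t /\ forall i, i \in S -> F i x) p M /\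
      s1 / descent_cst K d <= `|\det M| &
    forall p M, simplex_in (fun x => x 0 k0 <= t /\ forall i, i \in S :\ k -> F i x) p M ->
      `|\det M| < s1].
Proof.
move=> cS cF FR s10 [p1 [M1 [pM1 sM1]]].
have d0 : (0 < d)%N by apply: leq_ltn_trans (ltn_ord k0).
have [i0 i0S] : exists i, i \in S.
  by apply/finset.set0Pn; rewrite -card_gt0 cS muln_gt0.
pose C := helly_cst d (d.+1%:R^-1 : K).
have C1 : 1 <= C by apply: helly_cst_ge1 => //; rewrite invr_gt0.
have C0 : 0 < C by rewrite (lt_le_trans ltr01).
pose v0 := s1 / descent_cst K d.
have pow2 : 0 < 2 ^+ d :> K by rewrite exprn_gt0.
have v00 : 0 < v0 by rewrite divr_gt0// mulr_gt0.
pose A t (x : 'rV[K]_d) := x 0 k0 <= t /\ forall i, i \in S -> F i x.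
have AR t x : A t x -> forall k, `|x 0 k| <= Rb by move=> [_ /(_ _ i0S)]; exact: FR.
pose P t := exists p M, simplex_in (A t) p M /\ v0 <= `|\det M|.
apply: contrapT => nH.
have H k t : k \in S -> P t -> exists p M,
    simplex_in (fun x => x 0 k0 <= t /\ forall i, i \in S :\ k -> F i x) p M /\ s1 <= `|\det M|.
  move=> kS Pt; apply: contrapT => nM; apply: nH; exists k, t; split => // p M pM.
  by rewrite ltNge; apply/negP => sM; apply: nM; exists p, M.
have Rb0 : 0 <= Rb by rewrite (le_trans _ (FR _ i0S p1 (pM1 None i0 i0S) k0)).
pose B := 2 * Rb + 1.
pose B2 := d%:R * ((d`!)%:R * B ^+ d).
have B20 : 0 < B2.
  by rewrite mulr_gt0 ?ltr0n// mulr_gt0 ?ltr0n ?fact_gt0// exprn_gt0// /B; lra.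
(* Helly gives determinant at least [s1 / C], and height [e] allows at most [e * B2]; hence
   [2 * delta <= e]. *)
pose delta := s1 / C / B2 / 2.
have delta0 : 0 < delta by rewrite !divr_gt0.
have stepP t : P t -> P (t - delta).
  move=> Pt.
  have [|p [M [pM vM maxM]]] := near_max_simplex (B := (d`!)%:R * B ^+ d) v00 Pt.
    move=> q N qN; apply: normr_det_le => i j.
    by rewrite (le_trans (simplex_det_le (@AR t) qN i j))// /B lerDl.
  have M0 : \det M != 0 by rewrite -normr_gt0 (lt_le_trans v00).
  have sM : s1 <= C * `|\det M|.
    (* Helly is applied to [2 * d + 1] sets: the members of [S], and the half-space at index [None].
       Indices outside [S] impose no condition. *)
    pose D (o : option I) (x : 'rV[K]_d) : Prop :=
      if o is Some i then (i \in S -> F i x) else x 0 k0 <= t.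
    have DE x : (forall o, D o x) <-> A t x.
      split=> [Dx|[tx Fx] [i|]//]; last exact: Fx.
      by split=> [|i]; [exact: (Dx None)|exact: (Dx (Some i))].
    have splxE q N : (forall o, simplex_in (D o) q N) <-> simplex_in (A t) q N.
      by split=> [Dx o|AN o v]; [apply/DE => v; exact: Dx|exact: (DE _).2 (AN v) o].
    apply: (@helly_near_max _ _ _ None D _ p M) => //.
    - move=> [i|]; last exact: is_convex_halfspace.
      by move=> Y X x XA xC iS; apply: (cF i Y X x) => // y; exact: XA.
    - exact/splxE.
    - by move=> q N /splxE; exact: maxM.
    (* Either [J] misses some [k] in [S], and [H] applies, or [J] contains [S]. In the second case
       the cardinality bound excludes the half-space and the initial simplex serves. *)
    - move=> J Jd; have [[k kS kJ]|nk] := pselect (exists2 k, k \in S & Some k \notin J).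
        have [q [N [qN sN]]] := H k t kS Pt; exists q, N; split => // -[i|] iJ v /=.
          move=> iS; apply: (qN v).2; rewrite !inE iS andbT.
          by apply: contraNneq kJ => <-.
        exact: (qN v).1.
      have SJ : [set Some k | k in S] \subset J.
        apply/fintype.subsetP => _ /imsetP[k kS ->]; apply: contrapT => /negP kJ.
        by apply: nk; exists k.
      have /eqP JE : [set Some k | k in S] == J.
        by rewrite eqEcard SJ card_imset ?cS//; exact: Some_inj.
      exists p1, M1; split => // -[i|]; rewrite -JE => /imsetP[]// k kS [->] v _.
      exact: pM1.
  have [v vmin] : exists o, forall o', vertex p M o 0 k0 <= vertex p M o' 0 k0.
    case: (@arg_minP _ _ _ None predT (fun o => vertex p M o 0 k0) isT) => o _ h.
    by exists o => o'; exact: h.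
  pose q := vertex p M v; pose e := t - q 0 k0.
  have Me k : `|M k k0| <= e.
    have := vmin (Some k); have := vmin None; have := (pM (Some k)).1; have := (pM None).1.
    rewrite /e /q /= !mxE ler_norml => h1 h2 h3 h4; apply/andP; split; lra.
  have MB i j : `|M i j| <= B.
    by rewrite (le_trans (simplex_det_le (@AR t) pM i j))// /B lerDl.
  have eB : `|\det M| <= e * B2 by apply: normr_det_col_le => //; rewrite /B; lra.
  have e2 : 2 * delta <= e.
    rewrite /delta mulrC divfK ?pnatr_eq0// ler_pdivrMr// ler_pdivrMr// (le_trans sM)//.
    by rewrite mulrC ler_wpM2r// ltW.
  (* Averaging with the lowest vertex [q] brings every height from at most [t] to at most
     [t - e / 2]. *)
  exists (2^-1 *: (p + q)), (2^-1 *: M); split; last first.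
    rewrite detZ normrM ger0_norm ?exprn_ge0 ?invr_ge0//.
    rewrite exprVn mulrC ler_pdivlMr// /v0 /descent_cst invfM mulrA divfK ?gt_eqF//.
    by rewrite ler_pdivrMr// mulrC.
  move=> o'; rewrite vertexZ; split.
    rewrite !mxE -/q; have := (pM o').1; move: e2; rewrite /e; lra.
  move=> i iS; apply: is_convex_mid => //; [exact: (pM o').2|exact: (pM v).2].
have P0 : P Rb.
  exists p1, M1; split.
    move=> o; split=> [|i iS]; last exact: pM1.
    by rewrite (le_trans (ler_norm _))//; apply: (FR i0 i0S); exact: pM1.
  rewrite (le_trans _ sM1)// ler_pdivrMr ?descent_cst_gt0// ler_peMr ?(ltW s10)//.
  by rewrite -[leLHS]mulr1 ler_pM// exprn_ege1// ler1n.
have Pn n : P (Rb - delta * n%:R).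
  elim: n => [|n IH]; first by rewrite mulr0 subr0.
  by rewrite -natr1 mulrDr mulr1 opprD addrA; exact: stepP.
have Plb t : P t -> - Rb <= t.
  move=> [p [M [pM _]]]; have := AR _ _ (pM None) k0; have := (pM None).1.
  by rewrite ler_norml => h /andP[h1 _]; lra.
have := Plb _ (Pn (Num.bound (2 * Rb / delta))).
have : 2 * Rb / delta < (Num.bound (2 * Rb / delta))%:R.
  by apply: archi_boundP; apply: divr_ge0; [exact: mulr_ge0|exact: ltW].
rewrite ltr_pdivrMr// [_ * delta]mulrC; set m := delta * _; lra.
Qed.

(** * Double counting and the grid pigeonhole *)

Lemma pigeonhole (I T : finType) (f : I -> T) (E : {set I}) (A : {set T}) t0 :
  t0 \in A -> (forall i, i \in E -> f i \in A) ->
  exists2 t, t \in A & (#|E| <= #|[set i in E | f i == t]| * #|A|)%N.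
Proof.
move=> t0A fA.
case: (@arg_maxnP T t0 (mem A) (fun t => #|[set i in E | f i == t]|) t0A) => t tA tmax.
exists t => //; rewrite -sum1_card (partition_big f (mem A))//= mulnC -sum_nat_const.
apply: leq_sum => u uA; rewrite sum1_card; apply: leq_trans (tmax u uA).
by apply/eq_leq/eq_card => i; rewrite !inE.
Qed.

(** Each [S] charges [S :\ kappa S], and [T] is a most charged set. On the sets charging [T] the map
    [kappa] is injective, since [S] is recovered as [kappa S |: T]. *)
Lemma charging (I : finType) (m : nat) (G : {set {set I}}) (kappa : {set I} -> I) :
  (m <= #|I|)%N -> (forall S, S \in G -> #|S| = m.+1 /\ kappa S \in S) ->
  exists T E : {set I}, [/\ #|T| = m,
    forall i, i \in E -> [/\ i \notin T, i |: T \in G & kappa (i |: T) = i]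
    & (#|G| <= #|E| * 'C(#|I|, m))%N].
Proof.
move=> mI Gk.
have [T0 T0m] : exists T : {set I}, T \in [set T : {set I} | #|T| == m].
  by apply/finset.set0Pn; rewrite -card_gt0 card_draws bin_gt0.
have [|T] := pigeonhole (f := fun S => S :\ kappa S) (E := G) T0m.
  move=> S /Gk[Sm kS]; rewrite inE; move: Sm; rewrite (cardsD1 (kappa S)) kS add1n.
  by move=> -[->].
rewrite inE card_draws => /eqP Tm GT.
exists T, [set i | [&& i \notin T, i |: T \in G & kappa (i |: T) == i]]; split => //.
  by move=> i; rewrite inE => /and3P[? ? /eqP].
rewrite (leq_trans GT)// leq_mul2r; apply/orP; right.
rewrite -(card_in_imset (f := kappa)); last first.
  move=> S S'; rewrite !inE => /andP[/Gk[_ kS] /eqP ST] /andP[/Gk[_ kS'] /eqP ST'] kk.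
  by rewrite -(finset.setD1K kS) -(finset.setD1K kS') ST ST' kk.
apply: subset_leq_card; apply/fintype.subsetP => _ /imsetP[S + ->].
rewrite !inE => /andP[SG /eqP ST]; have [_ kS] := Gk _ SG.
have SE : kappa S |: T = S by rewrite -ST finset.setD1K.
by rewrite SE SG eqxx -ST !inE eqxx.
Qed.

(** One factor [k.+1] comes from the ratio of consecutive binomial coefficients, the other from
    [n <= (n - k) * k.+1]. *)
Lemma bin_ratio_le (K : realFieldType) (alpha e : K) n k : (k < n)%N -> 0 <= alpha ->
  alpha * 'C(n, k.+1)%:R <= e * 'C(n, k)%:R -> alpha * n%:R <= e * k.+1%:R ^+ 2.
Proof.
move=> kn a0 H.
have C0 : 0 < 'C(n, k)%:R :> K by rewrite ltr0n bin_gt0 ltnW.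
have H1 : alpha * (n - k)%:R <= e * k.+1%:R.
  rewrite -(ler_pM2r C0) -mulrA -natrM -mul_bin_left natrM.
  by rewrite mulrCA mulrAC mulrC ler_wpM2r.
have : n%:R <= (n - k)%:R * k.+1%:R :> K.
  rewrite -natrM ler_nat; have : (0 < n - k)%N by rewrite subn_gt0.
  rewrite -{2}(subnK (ltnW kn)); case: (n - k)%N => // j _.
  by rewrite mulnS mulSn; lia.
move=> /(ler_wpM2l a0) /le_trans; apply.
by rewrite mulrA expr2 mulrA ler_wpM2r.
Qed.

Lemma sum_ord_const (K : pzSemiRingType) d (x : K) : \sum_(i < d) x = d%:R * x.
Proof. by rewrite sumr_const card_ord mulr_natl. Qed.

(* A point deep inside the simplex (q0, N0) lies in every nearby simplex (q, N). *)
Lemma simplex_perturb (K : realFieldType) d (q0 q a : 'rV[K]_d) (N0 N : 'M[K]_d)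
    (delta rho eta : K) : 0 < rho -> rho <= `|\det N| ->
  (forall k, `|q0 0 k - q 0 k| <= delta) -> (forall k l, `|N0 k l - N k l| <= delta) ->
  (forall k l, `|N k l| <= 4) ->
  (forall k, eta <= a 0 k) -> 0 <= eta -> \sum_k a 0 k <= 1 - eta ->
  d%:R * (d%:R * (2 * delta * ((d`!)%:R * 4 ^+ d / rho))) <= eta ->
  exists a' : 'rV[K]_d, [/\ forall k, 0 <= a' 0 k, \sum_k a' 0 k <= 1 &
    q0 + a *m N0 = q + a' *m N].
Proof.
move=> rho0 rhoN qd Nd N4 aeta eta0 a1 small.
have N0' : 0 < `|\det N| by rewrite (lt_le_trans rho0).
have Nu : N \in unitmx by rewrite unitmxE unitfE -normr_gt0.
(* [e] is the displacement of the point when the simplex changes. Its coordinates with respect to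
   [N] are bounded through the adjugate and corrected in [a']. *)
pose e := q0 - q + a *m (N0 - N).
have a0 k : 0 <= a 0 k by rewrite (le_trans eta0).
have e2 k : `|e 0 k| <= 2 * delta.
  rewrite !mxE (le_trans (ler_normD _ _))// mulrDl mul1r lerD//.
  have d0 : 0 <= delta by rewrite (le_trans _ (qd k)).
  rewrite (le_trans (ler_norm_sum _ _ _))// (@le_trans _ _ (\sum_l a 0 l * delta))//.
    by apply: ler_sum => l _; rewrite normrM ger0_norm// !mxE ler_wpM2l.
  by rewrite -mulr_suml ler_piMl// (le_trans a1)// gerBl.
pose B := (d`!)%:R * 4 ^+ d / rho : K.
have invB k l : `|invmx N k l| <= B.
  rewrite /invmx Nu mxE normrM normfV mulrC ler_pM ?invr_ge0//.
    by apply: normr_adj_le; rewrite ?ler1n.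
  by rewrite lef_pV2 ?posrE.
have eB l : `|(e *m invmx N) 0 l| <= d%:R * (2 * delta * B).
  rewrite mxE (le_trans (ler_norm_sum _ _ _))// -sum_ord_const.
  by apply: ler_sum => k _; rewrite normrM ler_pM.
have d0sum : \sum_l `|(e *m invmx N) 0 l| <= eta.
  rewrite (le_trans _ small)//.
  rewrite -sum_ord_const.
  exact: ler_sum.
exists (a + e *m invmx N); split.
- move=> k; rewrite mxE; have : `|(e *m invmx N) 0 k| <= eta.
    rewrite (le_trans _ d0sum)// (bigD1 k)//= lerDl sumr_ge0//.
  by rewrite ler_norml => /andP[h _]; have := aeta k; lra.
- under eq_bigr do rewrite mxE; rewrite big_split/=.
  have : \sum_l (e *m invmx N) 0 l <= eta.
    by rewrite (le_trans _ d0sum)//; apply: ler_sum => l _; exact: ler_norm.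
  by lra.
- rewrite mulmxDl mulmxKV// /e mulmxBr; move: (a *m N0) (a *m N) => X Y.
  by apply/rowP => k; rewrite !mxE; ring.
Qed.

Lemma truncn_eq_dist (K : realType) (x y : K) : 0 <= x -> 0 <= y ->
  Num.truncn x = Num.truncn y -> `|x - y| <= 1.
Proof.
move=> /truncn_itv /andP[h1 h2] /truncn_itv /andP[h3 h4] xy.
move: h1 h2; rewrite xy => h1 h2; move: h2 h4; rewrite -natr1 => h2 h4.
by rewrite ler_norml; apply/andP; split; lra.
Qed.

(** Cells of width [L%:R^-1] on the interval from -4 to 4. There the truncation is at most [8 * L],
    so [inord] does not fall back to its default. *)
Definition grid (K : realType) (L : nat) (x : K) : 'I_(8 * L).+1 :=
  inord (Num.truncn ((x + 4) * L%:R)).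

Lemma grid_dist (K : realType) (L : nat) (x y : K) : (0 < L)%N ->
  `|x| <= 4 -> `|y| <= 4 -> grid L x = grid L y -> `|x - y| <= L%:R^-1.
Proof.
move=> L0 x4 y4 /(congr1 val); have LK : 0 < L%:R :> K by rewrite ltr0n.
have in4 (z : K) : `|z| <= 4 -> 0 <= (z + 4) * L%:R /\ (Num.truncn ((z + 4) * L%:R) < (8 * L).+1)%N.
  rewrite ler_norml => /andP[z1 z2].
  have h : 0 <= (z + 4) * L%:R by rewrite mulr_ge0//; lra.
  split => //; rewrite ltnS -(ler_nat K) natrM.
  by have /andP[/le_trans + _] := truncn_itv h; apply; rewrite ler_wpM2r//; lra.
have [x0 xL] := in4 _ x4; have [y0 yL] := in4 _ y4.
rewrite /= !inordK// => /(truncn_eq_dist x0 y0).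
rewrite -mulrBl normrM (ger0_norm (ltW LK)) opprD addrACA subrr addr0.
by rewrite -ler_pdivlMr// div1r.
Qed.

(** In the coordinates of a near-maximal simplex of [A], the given simplices have entries at most 4
    and determinants at least [rho]. They fall into finitely many grid cells, whose number depends
    only on [d] and [rho], and a shrunken copy of one simplex lies in all those of its cell. *)
Lemma common_simplex (K : realType) d (rho : K) : (0 < d)%N -> 0 < rho ->
  exists N : nat, (0 < N)%N /\ forall (I : finType) (E : {set I}) (i0 : I)
    (A : 'rV[K]_d -> Prop) (F : I -> 'rV[K]_d -> Prop) (s : K),
  0 < s -> i0 \in E -> (forall i, is_convex (F i)) ->
  (forall p M, simplex_in A p M -> `|\det M| <= s) ->
  (forall i, i \in E -> exists p M,
     simplex_in (fun x => A x /\ F i x) p M /\ rho * s <= `|\det M|) ->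
  exists E' : {set I}, (#|E| <= #|E'| * N)%N /\ exists p M,
    (forall i, i \in E' -> simplex_in (F i) p M) /\ rho * s / 2 ^+ d <= `|\det M|.
Proof.
move=> d0 rho0.
pose beta : K := d.+1%:R^-1; have beta0 : 0 < beta by rewrite invr_gt0.
pose B : K := d%:R * (d%:R * (2 * ((d`!)%:R * 4 ^+ d / rho))).
have B0 : 0 < B.
  by rewrite !mulr_gt0 ?ltr0n ?invr_gt0// ?fact_gt0// exprn_gt0.
pose L := (Num.bound (B / (beta / 2))).
have L0 : (0 < L)%N.
  rewrite -(ltr_nat K); apply: le_lt_trans (archi_boundP _); by rewrite !divr_ge0// ?ltW// divr_gt0.
have LK : 0 < L%:R :> K by rewrite ltr0n.
have LB : B / L%:R <= beta / 2.
  rewrite ler_pdivrMr// mulrC -ler_pdivrMr ?divr_gt0// ltW//.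
  by apply: archi_boundP; rewrite !divr_ge0// ?ltW// divr_gt0.
pose T := ({ffun 'I_d -> 'I_(8 * L).+1} * {ffun 'I_d * 'I_d -> 'I_(8 * L).+1})%type.
exists #|[set: T]|; split.
  by rewrite cardsT; apply/card_gt0P; exists ([ffun=> ord0], [ffun=> ord0]).
move=> I E i0 A F s s0 i0E cF As EF.
have rs0 : 0 < rho * s by rewrite mulr_gt0.
have [p [M [pM vM maxM]]] : exists p M, [/\ simplex_in A p M, rho * s <= `|\det M| &
    forall q N, simplex_in A q N -> `|\det N| <= 2 * `|\det M|].
  apply: (near_max_simplex (B := s)) => //.
  have [p [M [pM sM]]] := EF _ i0E; exists p, M; split => // o; exact: (pM o).1.
have M0 : \det M != 0 by rewrite -normr_gt0 (lt_le_trans rs0).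
have Mpos : 0 < `|\det M| by rewrite normr_gt0.
have Mu : M \in unitmx by rewrite unitmxE unitfE.
have /choice[f fP] : forall i, exists pM : 'rV[K]_d * 'M[K]_d, i \in E ->
   simplex_in (fun x => A x /\ F i x) pM.1 pM.2 /\ rho * s <= `|\det pM.2|.
  move=> i; have [iE|_] := boolP (i \in E); last by exists (0, 0).
  by have [q [N ?]] := EF _ iE; exists (q, N).
pose q i := ((f i).1 - p) *m invmx M; pose N i := (f i).2 *m invmx M.
have vE i o : vertex (q i) (N i) o = (vertex (f i).1 (f i).2 o - p) *m invmx M.
  by case: o => [k|] //=; rewrite /q /N row_mul -mulmxDl addrAC.
have v2 i o k : i \in E -> `|vertex (q i) (N i) o 0 k| <= 2.
  move=> iE; rewrite vE; apply: (near_max_coord pM) => //.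
  exact: ((fP i iE).1 o).1.
have q4 i k : i \in E -> `|q i 0 k| <= 4.
  by move=> iE; rewrite (le_trans (v2 i None k iE))// ler_nat.
have N4 i k l : i \in E -> `|N i k l| <= 4.
  move=> iE; have := v2 i (Some k) l iE; have := v2 i None l iE.
  by rewrite /= !mxE !ler_norml => /andP[? ?] /andP[? ?]; apply/andP; split; lra.
have Nrho i : i \in E -> rho <= `|\det (N i)|.
  move=> iE; rewrite det_mulmx det_inv normrM normfV ler_pdivlMr//.
  by rewrite (le_trans _ (fP i iE).2)// ler_wpM2l ?(ltW rho0)//; exact: As pM.
pose cell i : T := ([ffun k => grid L (q i 0 k)], [ffun kl => grid L (N i kl.1 kl.2)]).
have [|c _ Ec] := pigeonhole (f := cell) (E := E) (finset.in_setT (cell i0)).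
  by move=> i _; rewrite inE.
have [r rE'] : exists r, r \in [set i in E | cell i == c].
  apply/finset.set0Pn; rewrite -card_gt0 lt0n; apply: contraTneq Ec => ->.
  by rewrite mul0n -ltnNge card_gt0; apply/finset.set0Pn; exists i0.
exists [set i in E | cell i == c]; split => //.
move: rE'; rewrite inE => /andP[rE /eqP rc].
pose b : 'rV[K]_d := const_mx (beta / 2).
exists ((f r).1 + b *m (f r).2), (2^-1 *: (f r).2); split; last first.
  rewrite detZ normrM ger0_norm ?exprn_ge0 ?invr_ge0// exprVn mulrC.
  by rewrite ler_wpM2l ?invr_ge0 ?exprn_ge0// (fP r rE).2.
move=> i; rewrite inE => /andP[iE /eqP ic] o.
pose a : 'rV[K]_d := b + (if o is Some k then 2^-1 *: delta_mx 0 k else 0).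
have -> : vertex ((f r).1 + b *m (f r).2) (2^-1 *: (f r).2) o = (f r).1 + a *m (f r).2.
  rewrite /a mulmxDl; case: o {a} => [k|] /=; last by rewrite mul0mx addr0.
  rewrite -addrA; congr (_ + (_ + _)); rewrite -scalemxAl -rowE.
  by apply/rowP => l; rewrite !mxE.
have [|||||||a' [a'0 a'1 aE]] := simplex_perturb (q0 := q r) (q := q i) (a := a)
   (N0 := N r) (N := N i) (delta := L%:R^-1) (eta := beta / 2) rho0 (Nrho i iE).
- move=> k; apply: grid_dist; rewrite ?q4//.
  by move: ic; rewrite -rc => -[/ffunP/(_ k) + _]; rewrite !ffunE => ->.
- move=> k l; apply: grid_dist; rewrite ?N4//.
  by move: ic; rewrite -rc => -[_ /ffunP/(_ (k, l))]; rewrite !ffunE => ->.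
- by move=> k l; exact: N4.
- move=> k; rewrite /a !mxE lerDl; case: o {a} => [j|]; rewrite !mxE//.
  by rewrite mulr_ge0// invr_ge0.
- rewrite (eq_bigr (fun k => beta / 2 +
    (if o is Some j then 2^-1 *: delta_mx 0 j else 0 : 'rV[K]_d) 0 k)) => [|k _]; last first.
    by rewrite mxE [b 0 k]mxE.
  rewrite big_split/= sum_ord_const.
  have betad : d%:R * beta = 1 - beta.
    have : d.+1%:R * beta = 1 by rewrite mulfV ?pnatr_eq0.
    by rewrite -natr1 mulrDl mul1r; lra.
  have : \sum_k (if o is Some j then 2^-1 *: delta_mx 0 j else 0 : 'rV[K]_d) 0 k <= 2^-1.
    case: o {a} => [j|]; last by rewrite big1 ?invr_ge0// => k _; rewrite mxE.
    rewrite (bigD1 j)//= big1 => [|k /negbTE kj]; rewrite !mxE ?eqxx ?kj ?andbF.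
      by rewrite addr0 mulr1.
    by rewrite mulr0.
  by rewrite mulrA betad; lra.
- rewrite (le_trans _ LB)// /B; move: (_ / rho) (L%:R^-1) (d%:R : K) => x y z.
  by rewrite le_eqVlt; apply/orP; left; apply/eqP; ring.
clearbody a.
have -> : (f r).1 + a *m (f r).2 = (f i).1 + a' *m (f i).2.
  move: aE => /(congr1 (fun x => p + x *m M)).
  have qM j : q j *m M = (f j).1 - p by rewrite mulmxKV.
  have NM j : N j *m M = (f j).2 by rewrite mulmxKV.
  by rewrite !mulmxDl !qM -[a *m _ *m M]mulmxA -[a' *m _ *m M]mulmxA !NM addrA subrKC addrA subrKC.
apply: simplex_conv => // o'; exact: ((fP i iE).1 o').2.
Qed.

(** * The outer measure [vol] *)

Local Open Scope classical_set_scope.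

Lemma box_vol_ge0 d (B : 'I_d -> R * R) : 0 <= box_vol B.
Proof. by apply: prodr_ge0 => i _; rewrite le_max lexx orbT. Qed.

Lemma vol_ge0 d (A : set 'rV[R]_d) : (0 <= vol A)%E.
Proof.
apply: le_ereal_inf_tmp => _ [B _ <-].
by apply: nneseries_ge0 => k _ _; rewrite lee_fin box_vol_ge0.
Qed.

Lemma vol_mono d (A B : set 'rV[R]_d) : A `<=` B -> (vol A <= vol B)%E.
Proof.
move=> AB; apply: le_ereal_inf_tmp => _ [C BC <-]; apply: ereal_inf_lbound.
by exists C => //; exact: subset_trans BC.
Qed.

Lemma vol_le_cover d (A : set 'rV[R]_d) (B : nat -> 'I_d -> R * R) :
  A `<=` \bigcup_k box_set (B k) -> (vol A <= \sum_(0 <= k <oo) (box_vol (B k))%:E)%E.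
Proof. by move=> AB; apply: ereal_inf_lbound; exists B. Qed.

Lemma vol_cover_adherent d (A : set 'rV[R]_d) (e : R) : (vol A != +oo)%E -> 0 < e ->
  exists2 B : nat -> 'I_d -> R * R, A `<=` \bigcup_k box_set (B k) &
    (\sum_(0 <= k <oo) (box_vol (B k))%:E <= vol A + e%:E)%E.
Proof.
move=> volA e0; have volfin : vol A \is a fin_num.
  by rewrite ge0_fin_numE ?vol_ge0// lt_def leey eq_sym volA.
have [_ [B AB <-] /ltW ?] := lb_ereal_inf_adherent e0 volfin.
by exists B.
Qed.

Lemma vol_sigma_subadditive d (A : nat -> set 'rV[R]_d) :
  (vol (\bigcup_k A k) <= \sum_(0 <= k <oo) vol (A k))%E.
Proof.
have [[i Ai]|Afin] := pselect (exists i, vol (A i) = +oo%E).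
  by rewrite (eseries_pinfty _ _ Ai) ?leey// => k _; rewrite gt_eqF// (lt_le_trans _ (vol_ge0 _)).
apply/lee_addgt0Pr => e e0; apply: le_trans (epsilon_trick xpredT _ (ltW e0)); last first.
  by move=> k; exact: vol_ge0.
have /choice[B BP] : forall i, exists B : nat -> 'I_d -> R * R,
    A i `<=` \bigcup_k box_set (B k) /\
    (\sum_(0 <= k <oo) (box_vol (B k))%:E <= vol (A i) + (e / (2 ^ i.+1)%:R)%:E)%E.
  move=> i; have [||B AB Be] := @vol_cover_adherent _ (A i) (e / (2 ^ i.+1)%:R).
  - by apply/eqP => Ai; apply: Afin; exists i.
  - by rewrite divr_gt0.
  - by exists B.
apply: le_trans (lee_nneseries _ (fun i _ => (BP i).2)); last first.
  by move=> i _ _; apply: nneseries_ge0 => k _ _; rewrite lee_fin box_vol_ge0.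
have /card_esym/ppcard_eqP[f] := card_nat2.
pose b i k : \bar R := (box_vol (B i k))%:E.
have b0 i k : (0 <= b i k)%E by rewrite lee_fin box_vol_ge0.
rewrite (@le_trans _ _ (\sum_(0 <= k <oo) b (f k).1 (f k).2)%E)//.
  apply: vol_le_cover => x [i _] /(BP i).1[k _ xk].
  by exists (f^-1%FUN (i, k)) => //; rewrite invK ?inE.
rewrite [leLHS]nneseries_esumT//.
rewrite [leRHS]nneseries_esumT; last by move=> i; apply: nneseries_ge0 => k _ _; exact: b0.
rewrite [leRHS](eq_esum (b := fun i => (\esum_(k in setT) b i k)%E)); last first.
  by move=> i _; apply: nneseries_esumT => k; exact: b0.
rewrite esum_esum//.
rewrite (@reindex_esum _ _ _ [set: nat] _ f)//.
split=> [k _ //||[i k] _]; first by move=> k l _ _; apply: (inj (f := f)); rewrite inE.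
by exists (f^-1%FUN (i, k)); rewrite // invK ?inE.
Qed.

Lemma eseries_finite (u : nat -> \bar R) n :
  (forall k, (0 <= u k)%E) -> (forall k, (n <= k)%N -> u k = 0%E) ->
  (\sum_(0 <= k <oo) u k = \sum_(k < n) u k)%E.
Proof.
move=> u0 un; rewrite (nneseries_split 0 n)// add0n big_mkord.
by rewrite [X in (_ + X)%E]eseries0 ?adde0// => k nk _; exact: un.
Qed.

Lemma box_vol_null d (B : 'I_d -> R * R) i : (B i).2 <= (B i).1 -> box_vol B = 0.
Proof.
move=> Bi; rewrite /box_vol (bigD1 i)//= (_ : Num.max _ _ = 0) ?mul0r//.
by apply/max_idPr; rewrite subr_le0.
Qed.

(** The cover is completed by boxes degenerate in direction [i]; in dimension zero no box would have
    volume zero. *)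
Lemma vol_le_finite_cover d (i : 'I_d) (A : set 'rV[R]_d) n (B : nat -> 'I_d -> R * R) :
  (forall x, A x -> exists2 k, (k < n)%N & box_set (B k) x) ->
  (vol A <= (\sum_(k < n) box_vol (B k))%:E)%E.
Proof.
move=> AB; pose C k := if (k < n)%N then B k else fun=> (0, 0).
rewrite (le_trans (vol_le_cover (B := C) _))//.
  by move=> x /AB[k kn xk]; exists k => //; rewrite /C kn.
rewrite (eseries_finite (n := n)) => [|k|k nk].
- by rewrite sumEFin lee_fin; apply: ler_sum => k _; rewrite /C ltn_ord.
- by rewrite lee_fin box_vol_ge0.
- by rewrite /C ltnNge nk/= (@box_vol_null _ _ i).
Qed.

Lemma vol_box_le d (i : 'I_d) (B : 'I_d -> R * R) : (vol (box_set B) <= (box_vol B)%:E)%E.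
Proof.
have := @vol_le_finite_cover _ i (box_set B) 1 (fun=> B).
by rewrite big_ord1; apply => x Bx; exists 0.
Qed.

Lemma vol_set0 d (i : 'I_d) : vol (set0 : set 'rV[R]_d) = 0%E.
Proof.
apply/eqP; rewrite eq_le vol_ge0 andbT.
by have := @vol_le_finite_cover _ i set0 0 (fun _ _ => (0, 0)); rewrite big_ord0; apply.
Qed.

(* [box_set] and [box_vol] over an abstract [realType]: the concrete [R] carries no
   canonical measurable structure, which the integration argument below needs. *)
Definition rbox_set (K : realType) (d : nat) (B : 'I_d -> K * K) : set 'rV[K]_d :=
  [set x | forall i : 'I_d, (B i).1 <= x ord0 i <= (B i).2].

Definition rbox_vol (K : realType) (d : nat) (B : 'I_d -> K * K) : K :=
  \prod_(i < d) Num.max ((B i).2 - (B i).1) 0.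

Lemma rbox_vol_ge0 (K : realType) d (B : 'I_d -> K * K) : 0 <= rbox_vol B.
Proof. by apply: prodr_ge0 => i _; rewrite le_max lexx orbT. Qed.

Lemma rbox_volS (K : realType) d (B : 'I_d.+1 -> K * K) :
  rbox_vol B = Num.max ((B ord0).2 - (B ord0).1) 0 * rbox_vol (fun i => B (lift ord0 i)).
Proof. by rewrite /rbox_vol big_ord_recl. Qed.

Lemma rbox_setS (K : realType) d (B : 'I_d.+1 -> K * K) t (y : 'rV[K]_d) :
  rbox_set B (row_mx (t%:M : 'rV_1) y : 'rV_(1 + d)) <->
  (B ord0).1 <= t <= (B ord0).2 /\ rbox_set (fun i => B (lift ord0 i)) y.
Proof.
have E0 : (row_mx (t%:M : 'rV_1) y : 'rV_(1 + d)) ord0 ord0 = t.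
  by rewrite mxE; case: splitP => [j _|j /= h]; [rewrite (ord1 j) mxE|].
have Ei i : (row_mx (t%:M : 'rV_1) y : 'rV_(1 + d)) ord0 (lift ord0 i) = y ord0 i.
  rewrite mxE; case: splitP => [j /= ij|j /= ij].
    by have := ltn_ord j; rewrite -ij.
  by congr (y _ _); apply: val_inj; case: ij.
split=> [H|[H0 H] i].
  by split=> [|i]; [have := H ord0; rewrite E0|have := H (lift ord0 i); rewrite Ei].
by have [j ->|->] := unliftP ord0 i; [rewrite Ei|rewrite E0].
Qed.

(* Induction on the dimension: every slice is covered by the slices of the covering
   boxes, and the resulting inequality is integrated over the first coordinate. *)
Lemma rbox_vol_le_cover (K : realType) d (P : nat -> bool) (B : 'I_d -> K * K)
    (C : nat -> 'I_d -> K * K) :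
  (forall x, rbox_set B x -> exists2 k, P k & rbox_set (C k) x) ->
  ((rbox_vol B)%:E <= \sum_(0 <= k <oo) (if P k then rbox_vol (C k) else 0)%:E)%E.
Proof.
elim: d P B C => [|d IH] P B C BC.
  (* In dimension zero every box has volume 1, the empty product. Boxes that miss a slice are
     therefore discarded through [P] and not through their volume. *)
  have [|k Pk _] := BC 0; first by case.
  apply: le_trans (nneseries_lim_ge k.+1 _); last first.
    by move=> j _ _; rewrite lee_fin; case: ifP => // _; exact: rbox_vol_ge0.
  rewrite big_nat_recr//= Pk /rbox_vol !big_ord0 leeDr// sumEFin lee_fin sumr_ge0// => j _.
  by case: ifP => // _; exact: rbox_vol_ge0.
pose v k := if P k then rbox_vol (fun i => C k (lift ord0 i)) else 0.
pose I k := `[(C k ord0).1, (C k ord0).2]%classic : set K.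
pose D := `[(B ord0).1, (B ord0).2]%classic : set K.
have v0 k : 0 <= v k by rewrite /v; case: ifP => // _; exact: rbox_vol_ge0.
have mI k : measurable (I k) by exact: measurable_itv.
have mD : measurable D by exact: measurable_itv.
have lebE (a b : K) : lebesgue_measure `[a, b]%classic = (Num.max (b - a) 0)%:E.
  rewrite lebesgue_measure_itv /= lte_fin; case: ltP => ab.
    by rewrite max_l// subr_ge0 ltW.
  by rewrite max_r// subr_le0.
have slice t : D t -> ((rbox_vol (fun i => B (lift ord0 i)))%:E <=
    \sum_(0 <= k <oo) ((v k)%:E * (\1_(I k) t)%:E))%E.
  move=> Dt; have := IH (fun k => P k && (t \in I k)) (fun i => B (lift ord0 i))
    (fun k i => C k (lift ord0 i)).
  move=> /(_ _)/le_trans; apply.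
    move=> y By; have [|k Pk /rbox_setS[tI yC]] := BC (row_mx (t%:M : 'rV_1) y : 'rV_(1 + d)).
      by apply/rbox_setS; split => //; move: Dt; rewrite /D/= in_itv.
    by exists k => //; rewrite Pk/= inE /I/= in_itv.
  apply: lee_nneseries => [k _ _|k _].
    by rewrite lee_fin; case: ifP => // _; exact: rbox_vol_ge0.
  rewrite -EFinM lee_fin /v indicE.
  by case: (P k); case: (t \in _); rewrite /= ?mulr1 ?mulr0 ?mul0r.
pose f k (t : K) : \bar K := ((v k)%:E * (\1_(I k) t)%:E)%E.
have mf k : measurable_fun D (f k).
  apply: measurable_funeM; apply/measurable_EFinP; exact: measurable_indic.
have f0 k t : (0 <= (v k)%:E * (\1_(I k) t)%:E)%E by rewrite mule_ge0// lee_fin.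
rewrite rbox_volS EFinM -lebE -/D muleC.
rewrite -(integral_cst lebesgue_measure (measurable_itv _))//.
apply: (@le_trans _ _ (\int[lebesgue_measure]_(t in D)
  \sum_(0 <= k <oo) ((v k)%:E * (\1_(I k) t)%:E))%E).
  apply: ge0_le_integral => //.
  - by move=> t _; rewrite lee_fin rbox_vol_ge0.
  - apply: ge0_emeasurable_sum => // k _; exact: mf.
rewrite integral_nneseries//; apply: lee_nneseries => [k _ _|k _].
  by apply: integral_ge0 => t _.
rewrite ge0_integralZl_EFin//; last first.
  by apply/measurable_EFinP; apply: measurable_indic; exact: mI.
rewrite (integral_indic lebesgue_measure mD (mI k)).
apply: (@le_trans _ _ ((v k)%:E * lebesgue_measure (I k))%E).
  rewrite lee_wpmul2l ?lee_fin//; apply: le_measure; rewrite ?inE; [|exact: mI|exact: subIsetl].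
  exact: (measurableI _ _ (mI k) mD).
rewrite /I lebE -EFinM lee_fin /v; case: ifP => _; last by rewrite mul0r.
by rewrite rbox_volS mulrC.
Qed.

Lemma vol_box_ge d (B : 'I_d -> R * R) : ((box_vol B)%:E <= vol (box_set B))%E.
Proof.
apply: le_ereal_inf_tmp => _ [C BC <-].
have BC' x : rbox_set B x -> exists2 k, xpredT k & rbox_set (C k) x.
  by move=> /BC[k _ Ck]; exists k.
have := rbox_vol_le_cover BC'; apply: le_trans.
exact: lexx.
Qed.

(** * Change of volume under affine maps *)

Lemma vol_image_le d (i0 : 'I_d) (f : 'rV[R]_d -> 'rV[R]_d) (c : R) : 0 < c ->
  (forall B, (vol (f @` box_set B) <= (c * box_vol B)%:E)%E) ->
  forall A, (vol (f @` A) <= c%:E * vol A)%E.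
Proof.
move=> c0 fB A; rewrite -lee_pdivrMl//; apply: le_ereal_inf_tmp => _ [B AB <-].
rewrite lee_pdivrMl// -nneseriesZl; last by move=> k _; rewrite lee_fin box_vol_ge0.
apply: (@le_trans _ _ (\sum_(0 <= k <oo) vol (f @` box_set (B k)))%E).
  rewrite (le_trans _ (vol_sigma_subadditive _))//; apply: vol_mono.
  by move=> _ [x /AB[k _ xk] <-]; exists k => //; exists x.
by apply: lee_nneseries => [k _ _|k _]; [exact: vol_ge0|rewrite -EFinM].
Qed.

Lemma vol_translate d (i0 : 'I_d) (p : 'rV[R]_d) A : (vol [set (p + x)%R | x in A] <= vol A)%E.
Proof.
rewrite -[leRHS]mul1e; apply: vol_image_le => // B; rewrite mul1r.
pose C i := ((B i).1 + p ord0 i, (B i).2 + p ord0 i).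
have -> : box_vol B = box_vol C by apply: eq_bigr => i _; rewrite /C/=; congr Num.max; ring.
rewrite (le_trans _ (vol_box_le i0 C))//; apply: vol_mono => _ [x Bx <-] i.
by rewrite /C/= !mxE !(addrC _ (p ord0 i)) !lerD2l; exact: Bx.
Qed.

(** Only the upper bound is recorded; lower bounds come from applying it to the inverse matrix. *)
Definition scales_vol d (M : 'M[R]_d) :=
  forall A, (vol [set (x *m M)%R | x in A] <= `|\det M|%:E * vol A)%E.

Lemma scales_vol_mul d (M N : 'M[R]_d) :
  scales_vol M -> scales_vol N -> scales_vol (M *m N).
Proof.
move=> sM sN A; rewrite det_mulmx normrM mulrC EFinM -muleA.
apply: le_trans (lee_wpmul2l _ (sM A)); last by rewrite lee_fin.
rewrite (le_trans _ (sN _))//; apply: vol_mono => _ [x Ax <-].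
by exists (x *m M); [exists x|rewrite mulmxA].
Qed.

Lemma scales_vol_perm d (i0 : 'I_d) (s : 'S_d) : scales_vol (perm_mx s : 'M[R]_d).
Proof.
move=> A; apply: vol_image_le => // [|B].
  by rewrite det_perm normrX normrN1 expr1n.
rewrite det_perm normrX normrN1 expr1n mul1r.
pose C i := B (s^-1%g i).
have -> : box_vol B = box_vol C.
  by rewrite /box_vol (reindex_inj (@perm_inj _ s^-1%g)).
rewrite (le_trans _ (vol_box_le i0 C))//; apply: vol_mono => _ [x Bx <-] i.
rewrite /C -[s in perm_mx s]invgK -col_permE mxE; exact: Bx.
Qed.

Lemma slab_index (K : realFieldType) (n : nat) (u w : K) : 0 <= u <= n.+1%:R * w ->
  exists2 m, (m < n.+1)%N & m%:R * w <= u <= m.+1%:R * w.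
Proof.
elim: n => [|n IH] /andP[u0 un]; first by exists 0; rewrite ?mul0r ?u0.
have [un'|/ltW nu] := leP u (n.+1%:R * w); last by exists n.+1; rewrite ?nu.
by have [|m mn mu] := IH; [rewrite u0|exists m => //; exact: ltnW].
Qed.

Lemma mul_setrow1E (K : fieldType) d (i : 'I_d) (r x : 'rV[K]_d) j :
  (x *m setrow 1%:M i r) 0 j = (if j == i then 0 else x 0 j) + x 0 i * r 0 j.
Proof.
rewrite mxE (bigD1 i)//= mxE eqxx addrC; congr (_ + _).
case: ifP => [/eqP ->|/negbT ji].
  by rewrite big1// => k ki; rewrite !mxE (negbTE ki) mulr0.
rewrite (bigD1 j)//= !mxE (negbTE ji) eqxx mulr1 big1 ?addr0// => k /andP[ki kj].
by rewrite !mxE (negbTE ki) (negbTE kj) mulr0.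
Qed.

(* A box is cut into [n] slabs in the direction of row [i]; the image of each slab lies in
   a box exceeding it by O(1/n) in the other directions. *)
Lemma vol_slabs d (i : 'I_d) (r : 'rV[R]_d) (B : 'I_d -> R * R) (n : nat) :
  (forall j, (B j).1 <= (B j).2) ->
  (vol [set (x *m setrow 1%:M i r)%R | x in box_set B] <=
    (`|r ord0 i| * ((B i).2 - (B i).1) *
     \prod_(j | j != i) ((B j).2 - (B j).1 + `|r ord0 j| * ((B i).2 - (B i).1) / n.+1%:R))%:E)%E.
Proof.
move=> B12; set l := (B i).2 - (B i).1.
have nK : 0 < n.+1%:R :> R by rewrite ltr0n.
have l0 : 0 <= l by rewrite subr_ge0.
(* [h] is half the thickness of a slab and [c m] the middle of slab [m]. *)
pose h := l / n.+1%:R / 2.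
have h0 : 0 <= h by rewrite !divr_ge0// ltW.
have h2 : h * 2 = l / n.+1%:R by rewrite divfK// pnatr_eq0.
pose c (m : nat) := (B i).1 + (2 * m%:R + 1) * h.
pose C m j : R * R :=
  ((if j == i then 0 else (B j).1) + c m * r ord0 j - h * `|r ord0 j|,
   (if j == i then 0 else (B j).2) + c m * r ord0 j + h * `|r ord0 j|).
have CE m : box_vol (C m) = `|r ord0 i| * (l / n.+1%:R) *
     \prod_(j | j != i) ((B j).2 - (B j).1 + `|r ord0 j| * l / n.+1%:R).
  rewrite /box_vol (bigD1 i)//= eqxx; congr (_ * _).
    rewrite max_l; first by rewrite -h2; ring.
    have : 0 <= h * `|r ord0 i| by rewrite mulr_ge0.
    by lra.
  apply: eq_bigr => j /negbTE ->; rewrite max_l.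
    by rewrite -mulrA -h2; ring.
  have : 0 <= h * `|r ord0 j| by rewrite mulr_ge0.
  by have := B12 j; lra.
rewrite (le_trans (@vol_le_finite_cover _ i _ n.+1 C _))//.
  move=> _ [x Bx <-]; have /andP[x1 x2] := Bx i.
  have [|m mn /andP[m1 m2]] := @slab_index _ n (x ord0 i - (B i).1) (l / n.+1%:R).
    by rewrite mulrC divfK ?pnatr_eq0// subr_ge0 x1 /l lerD2r.
  exists m => // j.
  have xc : `|x ord0 i - c m| <= h.
    rewrite -h2 -natr1 in m1 m2; rewrite ler_norml /c; apply/andP; split.
      by move: m1; lra.
    by move: m2; lra.
  have : `|(x ord0 i - c m) * r ord0 j| <= h * `|r ord0 j|.
    by rewrite normrM ler_wpM2r.
  rewrite mulrBl ler_norml mul_setrow1E /C/= => /andP[y1 y2].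
  by case: eqP => [_|_]; [|have /andP[b1 b2] := Bx j]; apply/andP; split; lra.
rewrite lee_fin (eq_bigr (fun=> box_vol (C 0))) => [|m _]; last by rewrite !CE.
rewrite sum_ord_const CE mulrA [X in X * _](_ : _ = `|r ord0 i| * l)//.
by rewrite mulrCA [_ * (l / _)]mulrC divfK// pnatr_eq0.
Qed.

Lemma horner_inv_le (K : realType) (p : {poly K}) (e : K) : 0 < e ->
  exists n, p.[n.+1%:R^-1] <= p.[0] + e.
Proof.
move=> e0; have : (fun n => p.[harmonic n]) @ \oo --> p.[0].
  by apply: continuous_cvg; [exact: continuous_horner|exact: cvg_harmonic].
move=> /cvgrPdist_lt/(_ _ e0)[n _ /(_ n (leqnn _))]; rewrite /= => Pn; exists n.
by move: Pn; rewrite distrC ltr_norml => /andP[_]; rewrite ltrBlDl => /ltW.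
Qed.

Lemma scales_vol_setrow1 d (i : 'I_d) (r : 'rV[R]_d) : r ord0 i != 0 ->
  scales_vol (setrow 1%:M i r).
Proof.
move=> ri A; have detE : \det (setrow 1%:M i r) = r ord0 i.
  by rewrite -[r in setrow _ _ r]mulmx1 det_setrow_mulmx det1 mulr1.
rewrite detE; apply: vol_image_le => //; first by rewrite normr_gt0.
move=> B; have [B12|] := pselect (forall j, (B j).1 <= (B j).2); last first.
  move=> /existsNP[j /negP]; rewrite -ltNge => Bj.
  rewrite (_ : box_set B = set0) ?image_set0 ?(vol_set0 i).
    by rewrite lee_fin mulr_ge0// box_vol_ge0.
  rewrite -subset0 => x /(_ j) /andP[b1 b2].
  by have := le_trans b1 b2; rewrite leNgt Bj.
have slabs := vol_slabs i r _ B12.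
set l := (B i).2 - (B i).1 in slabs.
(* The slab estimate is a polynomial in [n.+1%:R^-1] whose constant term is the desired bound. *)
pose P : {poly R} := (`|r ord0 i| * l)%:P *
  \prod_(j | j != i) (((B j).2 - (B j).1)%:P + (`|r ord0 j| * l) *: 'X).
have PE x : P.[x] = `|r ord0 i| * l *
     \prod_(j | j != i) ((B j).2 - (B j).1 + `|r ord0 j| * l * x).
  by rewrite /P hornerM hornerC horner_prod; congr (_ * _); apply: eq_bigr => j _; rewrite !hornerE.
have -> : `|r ord0 i| * box_vol B = P.[0].
  rewrite PE /box_vol (bigD1 i)//= mulrA max_l ?subr_ge0//; congr (_ * _).
  by apply: eq_bigr => j _; rewrite mulr0 addr0 max_l// subr_ge0.
apply/lee_addgt0Pr => e e0.
have [n Pn] := horner_inv_le P e0.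
by rewrite (le_trans (slabs n))// -EFinD lee_fin -PE.
Qed.

Lemma scales_vol1 d : scales_vol (1%:M : 'M[R]_d).
Proof.
move=> A; rewrite det1 normr1 mul1e; apply: vol_mono => _ [x Ax <-].
by rewrite mulmx1.
Qed.

(* The injective ranking [rk] of the indices makes [M] lower triangular; ranking them in
   decreasing order covers upper triangular matrices. *)
Lemma scales_vol_triangular d (rk : 'I_d -> nat) (M : 'M[R]_d) : injective rk ->
  (forall i j, (rk i < rk j)%N -> M i j = 0) -> (forall i, M i i != 0) -> scales_vol M.
Proof.
move=> rk_inj.
suff H m : forall M : 'M[R]_d, (forall i, (m <= rk i)%N -> row i M = delta_mx 0 i) ->
    (forall i j, (rk i < rk j)%N -> M i j = 0) -> (forall i, M i i != 0) -> scales_vol M.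
  apply: (H (\max_i rk i).+1) => i; rewrite ltnNge => /negP[].
  exact: leq_bigmax.
elim: m => [|m IH] {}M Mid Mtri Mdiag.
  rewrite (_ : M = 1%:M); first exact: scales_vol1.
  by apply/row_matrixP => i; rewrite Mid// row1.
have [[i im]|ni] := pselect (exists i, rk i = m); last first.
  apply: IH => // i im; apply: Mid; rewrite ltn_neqAle im andbT.
  by apply/eqP => mi; apply: ni; exists i.
(* Column [i] vanishes off the diagonal: rows of higher rank are already those of the identity, and
   those of lower rank vanish there by triangularity. So row [i] splits off as an elementary
   factor. *)
have Mki k : k != i -> M k i = 0.
  move=> ki; have [ik|ik|/rk_inj ik] := ltngtP (rk i) (rk k).
  - have /rowP/(_ i) : row k M = delta_mx 0 k by apply: Mid; rewrite -im.
    by rewrite !mxE eqxx eq_sym (negbTE ki).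
  - exact: Mtri.
  - by rewrite ik eqxx in ki.
pose M' := setrow M i (delta_mx 0 i).
have -> : M = M' *m setrow 1%:M i (row i M).
  apply/row_matrixP => k; rewrite row_mul row_setrow; apply/rowP => l.
  rewrite mul_setrow1E; have [->|ki] := eqVneq k i.
    by rewrite !mxE !eqxx/= mul1r; case: eqP => //= _; rewrite add0r.
  rewrite [row k M 0 i]mxE Mki// mul0r addr0 mxE.
  by case: eqP => [->|_]; rewrite ?Mki// mxE.
apply: scales_vol_mul; last by apply: scales_vol_setrow1; rewrite mxE.
apply: IH => [k mk|k l kl|k]; rewrite ?row_setrow ?mxE.
- have [->//|ki] := eqVneq k i; apply: Mid.
  rewrite ltn_neqAle mk andbT -im; apply: contra_neq ki => /rk_inj//.
- case: eqP => [ki|_]; last exact: Mtri.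
  by rewrite eqxx/=; case: eqP => // li; rewrite ki li ltnn in kl.
- by have [_|_] := eqVneq k i; rewrite ?eqxx ?oner_neq0.
Qed.

(** By LUP decomposition, it suffices to treat permutation and triangular matrices. *)
Lemma scales_vol_unitmx d (M : 'M[R]_d.+1) : M \in unitmx -> scales_vol M.
Proof.
move=> Mu; have := cormen_lup_correct M; have := cormen_lup_perm M.
have := @cormen_lup_lower _ _ M; have := @cormen_lup_upper _ _ M; have := cormen_lup_detL M.
case: (cormen_lup M) => [[P L] U] /= detL Uup Llow /is_perm_mxP[s ->] PM.
have -> : M = perm_mx s^-1%g *m (L *m U).
  by rewrite -[L *m U]PM mulmxA -perm_mxM mulVg perm_mx1 mul1mx.
have U0 : \det U != 0.
  have /(congr1 determinant) : perm_mx s *m M = L *m U by exact: PM.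
  rewrite !det_mulmx detL mul1r => <-.
  by rewrite mulf_neq0 ?det_perm ?expf_neq0 ?oppr_eq0 ?oner_neq0// -unitfE -unitmxE.
have detU : \det U = \prod_i U i i.
  rewrite -det_tr det_trig; first by apply: eq_bigr => i _; rewrite mxE.
  by apply/is_trig_mxP => i j ij; rewrite mxE Uup.
apply: scales_vol_mul; first exact: scales_vol_perm ord0 _.
apply: scales_vol_mul.
- apply: (scales_vol_triangular (rk := val)) => [|i j ij|i]; first exact: val_inj.
    by rewrite Llow ?(ltnW ij)// -val_eqE/= ltn_eqF.
  by rewrite Llow// eqxx oner_neq0.
- apply: (scales_vol_triangular (rk := fun i => val (rev_ord i))) => [|i j|i].
  + by move=> i j /val_inj/rev_ord_inj.
  + by move=> ij; apply: Uup; move: ij => /=; have := ltn_ord i; have := ltn_ord j; lia.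
  + by move: U0; rewrite detU => /prodf_neq0/(_ i isT).
Qed.

(** * Volume and simplices *)

(** A largest independent family of differences [x - p] with [x] in [A] spans all such differences.
    It has fewer than [d] members, so a nonzero functional vanishes on it. *)
Lemma simplex_rank_deficient d (A : set 'rV[R]_d) :
  (forall p M, simplex_in A p M -> \det M = 0) ->
  forall p, A p -> exists2 f : 'cV[R]_d, f != 0 & forall x, A x -> (x - p) *m f = 0.
Proof.
move=> A0 p Ap.
pose P r := `[< exists N : 'M[R]_(r, d), row_free N /\ forall k, A (p + row k N) >].
have P0 : exists r, P r.
  exists 0%N; apply/asboolP; exists 0; split; last by case.
  by rewrite /row_free mxrank0.
have Pd r : P r -> (r <= d)%N.
  by move=> /asboolP[N [/eqP rN _]]; rewrite -[X in (X <= _)%N]rN rank_leq_col.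
case: (ex_maxnP P0 Pd) => r /asboolP[N [Nfree NA]] rmax.
have rd : (r < d)%N.
  rewrite ltn_neqAle Pd ?andbT; last by apply/asboolP; exists N.
  apply/eqP => rd; subst r; have detN : \det N = 0 by apply: (A0 p) => -[k|] /=.
  by move: Nfree; rewrite row_free_unit unitmxE unitfE detN eqxx.
have : cokermx N != 0.
  by rewrite -mxrank_eq0 mxrank_coker (eqP Nfree) -lt0n subn_gt0.
move=> /eqP/matrixP/existsNP[i /existsNP[j /eqP ij]].
exists (col j (cokermx N)).
  by apply/negP => /eqP/matrixP/(_ i 0); apply/eqP; rewrite !mxE in ij *.
move=> x Ax; suff : (x - p <= N)%MS.
  by rewrite submxE => /eqP xN; rewrite colE mulmxA xN mul0mx.
apply: contraT => xN; have : P r.+1; last by move=> /rmax; rewrite ltnn.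
apply/asboolP; rewrite -addn1; exists (col_mx N (x - p)); split.
  have : (N < N + (x - p))%MS by rewrite /ltmx addsmxSl addsmx_sub submx_refl.
  rewrite ltmxErank => /andP[_]; rewrite (eqP Nfree) addsmxE => rk.
  by rewrite /row_free eqn_leq rank_leq_row/=; apply: leq_trans rk; rewrite addn1.
move=> k; case: (split_ordP k) => j' ->; rewrite ?rowKu ?rowKd//.
by rewrite row_id subrKC.
Qed.

Lemma vol_hyperplane d (i : 'I_d) : vol [set y : 'rV[R]_d | y ord0 i = 0] = 0%E.
Proof.
apply/eqP; rewrite eq_le vol_ge0 andbT.
pose B (k : nat) (j : 'I_d) : R * R := if j == i then (0, 0) else (- k%:R, k%:R).
rewrite (le_trans (vol_le_cover (B := B) _))//.
  move=> y /= yi; exists (\max_j Num.bound `|y ord0 j|)%N => // j.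
  rewrite /B; case: eqP => [->|_] /=; first by rewrite yi lexx.
  rewrite -ler_norml (le_trans (ltW (archi_boundP (normr_ge0 _))))// ler_nat.
  exact: (leq_bigmax (F := fun j => Num.bound `|y ord0 j|)).
rewrite eseries0// => k _ _.
by rewrite (@box_vol_null _ _ i)// /B eqxx.
Qed.

Lemma vol_simplex_le d (A : set 'rV[R]_d.+1) s : 0 <= s ->
  (forall p M, simplex_in A p M -> `|\det M| <= s) ->
  (vol A <= (4 ^+ d.+1 * s)%:E)%E.
Proof.
move=> s0 As.
have [[p [M [pM M0]]]|A0] := pselect (exists p M, simplex_in A p M /\ \det M != 0).
  have {pM}[q [N [qN N0 maxN]]] : exists q N, [/\ simplex_in A q N, `|\det M| <= `|\det N|
      & forall q N', simplex_in A q N' -> `|\det N'| <= 2 * `|\det N|].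
    by apply: (near_max_simplex (B := s)) => //; [rewrite normr_gt0|exists p, M].
  have {}N0 : \det N != 0 by rewrite -normr_gt0 (lt_le_trans _ N0)// normr_gt0.
  have Nu : N \in unitmx by rewrite unitmxE unitfE.
  pose B (i : 'I_d.+1) : R * R := (-2, 2).
  have AB : A `<=` [set (q + y)%R | y in [set (z *m N)%R | z in box_set B]].
    move=> x Ax; exists (x - q); last by rewrite subrKC.
    exists ((x - q) *m invmx N); last by rewrite mulmxKV.
    by move=> i; rewrite -ler_norml; exact: (near_max_coord qN N0 maxN Ax).
  rewrite (le_trans (vol_mono AB))// (le_trans (vol_translate ord0 _ _))//.
  rewrite (le_trans (scales_vol_unitmx Nu _))//.
  have /le_trans : (`|\det N|%:E * vol (box_set B) <= `|\det N|%:E * (box_vol B)%:E)%E.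
    by rewrite lee_wpmul2l ?lee_fin// (vol_box_le ord0).
  apply; rewrite -EFinM lee_fin mulrC ler_pM//; first exact: box_vol_ge0.
    rewrite /box_vol (eq_bigr (fun=> 4)) => [|i _].
      by rewrite prodr_const card_ord.
    by rewrite /B/= max_l; lra.
  exact: As qN.
have {}A0 p M : simplex_in A p M -> \det M = 0.
  by move=> pM; apply/eqP; apply: contra_notT A0 => M0; exists p, M.
have [[p Ap]|/forallNP nA] := pselect (exists p, A p); last first.
  rewrite (le_trans (@vol_mono _ _ set0 _)) ?(vol_set0 ord0) ?lee_fin ?mulr_ge0 ?exprn_ge0//.
have [f f0 fA] := simplex_rank_deficient A0 Ap.
have [i fi] : exists i, f i 0 != 0.
  apply: contrapT => /forallNP nf; case/eqP: f0; apply/colP => i; rewrite mxE.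
  by apply: contrapT => /eqP fi; exact: (nf i).
(* [E] is an invertible change of coordinates that makes [f] the [i]-th coordinate, so [A] goes into
   a translate of a coordinate hyperplane. *)
pose E := (setrow 1%:M i f^T)^T.
have detE : \det E = f i 0.
  by rewrite det_tr -[f^T]mulmx1 det_setrow_mulmx det1 mulr1 mxE.
have Eu : E \in unitmx by rewrite unitmxE unitfE detE.
have yE y : (y *m E) 0 i = (y *m f) 0 0.
  by rewrite !mxE; apply: eq_bigr => k _; rewrite ?mxE ?eqxx ?mxE.
rewrite (@le_trans _ _ 0%E) ?lee_fin ?mulr_ge0 ?exprn_ge0//.
have AH : A `<=` [set (p + y)%R | y in
    [set (z *m invmx E)%R | z in [set z : 'rV[R]_d.+1 | z ord0 i = 0]]].
  move=> x Ax; exists (x - p); last by rewrite subrKC.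
  exists ((x - p) *m E); last by rewrite mulmxK.
  by rewrite /= yE fA// mxE.
rewrite (le_trans (vol_mono AH))// (le_trans (vol_translate ord0 _ _))//.
rewrite (le_trans (scales_vol_unitmx _ _)) ?unitmx_inv//.
by rewrite vol_hyperplane mule0.
Qed.

(** In simplex coordinates the cube of side [d.+1%:R^-1] at the vertex [p] lies in the simplex. The
    lower bound follows from [scales_vol] for [invmx M]. *)
Lemma vol_simplex_ge d (A : set 'rV[R]_d.+1) p M : is_convex A -> simplex_in A p M ->
  ((`|\det M| / d.+1%:R ^+ d.+1)%:E <= vol A)%E.
Proof.
move=> cA pM; have [M0|M0] := eqVneq (\det M) 0.
  by rewrite M0 normr0 mul0r vol_ge0.
have Mu : M \in unitmx by rewrite unitmxE unitfE.
have Mpos : 0 < `|\det M| by rewrite normr_gt0.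
pose B (i : 'I_d.+1) : R * R := (0, d.+1%:R^-1).
have BA : box_set B `<=` [set (y *m invmx M)%R | y in [set (- p + x)%R | x in A]].
  move=> z Bz; exists (z *m M); last by rewrite mulmxK.
  exists (p + z *m M); last by rewrite addKr.
  apply: simplex_conv => // [k|]; first by have /andP[] := Bz k.
  rewrite (@le_trans _ _ (\sum_(k < d.+1) d.+1%:R^-1))//.
    by apply: ler_sum => k _; have /andP[] := Bz k.
  by rewrite sum_ord_const mulfV ?pnatr_eq0.
have := le_trans (vol_box_ge B) (vol_mono BA).
move=> /le_trans/(_ (scales_vol_unitmx _ _)); rewrite unitmx_inv => /(_ Mu).
rewrite det_inv normfV -lee_pdivrMl ?invr_gt0// invrK => h.
have := le_trans h (vol_translate ord0 _ _); apply: le_trans.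
rewrite -EFinM lee_fin /box_vol (eq_bigr (fun=> d.+1%:R^-1)) => [|i _].
  by rewrite prodr_const card_ord exprVn.
by rewrite /B/= subr0 max_l// invr_ge0.
Qed.

(** Points are merged one at a time into a weighted average normalized by the partial weight; a tail
    of weight zero is treated apart. *)
Lemma convex_setP d (A : set 'rV[R]_d) : convex_set A -> is_convex A.
Proof.
move=> cA Y X x XA [w [w0 w1 ->]] {x}.
have mid a b (t : R) : 0 <= t -> t <= 1 -> A a -> A b -> A (t *: a + (1 - t) *: b).
  by move=> t0 t1 Aa Ab; have := cA a b (Itv01 t0 t1); rewrite !inE => /(_ Aa Ab).
suff H (r : seq Y) : 0 < \sum_(y <- r) w y ->
    A ((\sum_(y <- r) w y)^-1 *: \sum_(y <- r) w y *: X y).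
  by have := H (index_enum Y); rewrite w1 invr1 scale1r; apply.
elim: r => [|y r IH]; first by rewrite big_nil ltxx.
rewrite !big_cons; set W := \sum_(z <- r) w z; set S := \sum_(z <- r) _ => Wy.
have W0 : 0 <= W by exact: sumr_ge0.
have [W00|Wn0] := eqVneq W 0.
  have -> : S = 0.
    rewrite /S big_seq big1// => z zr; move: W00 => /eqP.
    by rewrite psumr_eq0// => /allP/(_ z zr)/eqP ->; rewrite scale0r.
  rewrite W00 addr0 in Wy; rewrite W00 !addr0 scalerA mulVf ?gt_eqF// scale1r; exact: XA.
have {}W0 : 0 < W by rewrite lt_def Wn0.
have := mid (X y) (W^-1 *: S) (w y / (w y + W)) _ _ (XA y) (IH W0).
rewrite (_ : _ *: _ + _ = (w y + W)^-1 *: (w y *: X y + S)); last first.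
  rewrite scalerDr !scalerA; congr (_ *: _ + _ *: _); first by rewrite mulrC.
  by field; rewrite !gt_eqF.
apply; first by rewrite divr_ge0 ?(ltW Wy).
by rewrite ler_pdivrMr// mul1r lerDl ltW.
Qed.

(** * Dimension one *)

Lemma is_convex_subfam d n (F : 'I_n -> set 'rV[R]_d) (S : {set 'I_n}) :
  (forall i, is_convex (F i)) -> is_convex (subfam_inter F S).
Proof. by move=> cF Y X x XA xC i iS; apply: (cF i Y X) => // y; exact: XA. Qed.

Lemma vol_le_width (A : set 'rV[R]_1) s : 0 <= s ->
  (forall x y, A x -> A y -> y 0 0 - x 0 0 <= s) -> (vol A <= s%:E)%E.
Proof.
move=> s0 As; have [[x0 Ax0]|/forallNP nA] := pselect (exists x, A x); last first.
  by rewrite (le_trans (@vol_mono _ _ set0 _)) ?(vol_set0 ord0) ?lee_fin.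
pose E : set R := [set t | exists2 x, A x & t = x 0 0].
have lbE : lbound E (x0 0 0 - s).
  by move=> _ [x Ax ->]; have := As x x0 Ax Ax0; lra.
have infE x : A x -> inf E <= x 0 0.
  by move=> Ax; apply: ge_inf; [exists (x0 0 0 - s)|exists x].
pose B (i : 'I_1) : R * R := (inf E, inf E + s).
have AB : A `<=` box_set B.
  move=> x Ax i; rewrite ord1 infE//= -lerBlDr; apply: lb_le_inf.
    by exists (x0 0 0), x0.
  by move=> _ [y Ay ->]; have := As y x Ay Ax; lra.
rewrite (le_trans (vol_mono AB))// (le_trans (vol_box_le ord0 B))//.
by rewrite /box_vol big_ord1 /B/= lee_fin addrAC subrr add0r ge_max lexx.
Qed.

Lemma is_convex_between (A : set 'rV[R]_1) (x y z : 'rV[R]_1) : is_convex A -> A x -> A y ->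
  x 0 0 <= z 0 0 -> z 0 0 <= y 0 0 -> A z.
Proof.
move=> cA Ax Ay xz zy.
have [xy|xy] := eqVneq (x 0 0) (y 0 0).
  by suff -> : z = x by []; apply/rowP => i; rewrite ord1; apply/eqP; rewrite eq_le xz xy zy.
have xy0 : 0 < y 0 0 - x 0 0 by rewrite subr_gt0 lt_neqAle xy (le_trans xz zy).
pose a : 'rV[R]_1 := const_mx ((z 0 0 - x 0 0) / (y 0 0 - x 0 0)).
have -> : z = x + a *m (y - x).
  by apply/rowP => i; rewrite ord1 !mxE big_ord1 !mxE divfK ?gt_eqF// subrKC.
apply: simplex_conv => // [[k|]|k|].
- by rewrite /= ord1 row_id subrKC.
- by [].
- by rewrite mxE divr_ge0 ?(ltW xy0)// subr_ge0.
- by rewrite big_ord1 mxE ler_pdivrMr// mul1r lerD2r.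
Qed.

(** This stands for the order of left ends, which need be neither finite nor attained. *)
Definition lower (A B : set 'rV[R]_1) := forall x, B x -> exists2 y, A y & y 0 0 <= x 0 0.

Lemma lower_total (A B : set 'rV[R]_1) : lower A B \/ lower B A.
Proof.
have [AB|/existsNP[x /not_implyP[Bx nA]]] := pselect (lower A B); [by left|right].
move=> y Ay; exists x => //; rewrite leNgt; apply/negP => /ltW yx.
by apply: nA; exists y.
Qed.

Lemma lower_refl A : lower A A.
Proof. by move=> x Ax; exists x. Qed.

Lemma vol_ge1_width (A : set 'rV[R]_1) (e : R) : (1%:E <= vol A)%E -> 0 < e -> e < 1 ->
  exists x y, [/\ A x, A y & 1 - e <= y 0 0 - x 0 0].
Proof.
move=> vA e0 e1; apply: contrapT => nA.
have : (vol A <= (1 - e)%:E)%E.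
  apply: vol_le_width => [|x y Ax Ay]; first lra.
  by rewrite leNgt; apply/negP => xy; apply: nA; exists x, y; split => //; exact: ltW.
by move=> /(le_trans vA); rewrite lee_fin; lra.
Qed.

Lemma vol_pairs_line n (F : 'I_n -> set 'rV[R]_1) (t : 'I_n) (E : {set 'I_n}) i0 :
  i0 \in E -> (forall i, is_convex (F i)) -> (forall i, i \in E -> lower (F i) (F t)) ->
  (forall i, i \in E -> (1%:E <= vol (F i `&` F t))%E) ->
  (1%:E <= vol (subfam_inter F E))%E.
Proof.
move=> i0E cF low volF; apply/lee_addgt0Pr => e e0.
have [e1|e1] := leP 1 e.
  by rewrite -[leLHS]add0e leeD ?vol_ge0// lee_fin.
have /choice[f fP] : forall i, exists xy : 'rV[R]_1 * 'rV[R]_1, i \in E ->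
    [/\ (F i `&` F t) xy.1, (F i `&` F t) xy.2 & 1 - e <= xy.2 0 0 - xy.1 0 0].
  move=> i; have [iE|_] := boolP (i \in E); last by exists (0, 0).
  by have [x [y ?]] := vol_ge1_width (volF i iE) e0 e1; exists (x, y).
(* The common segment runs from the least left point [x] to the least right point [y]. As [x] lies
   in [F t], every [F j] has a point at or left of [x], and so contains [x] by convexity. *)
case: (@arg_minP _ _ _ i0 (mem E) (fun i => (f i).1 0 0) i0E) => a aE amin.
case: (@arg_minP _ _ _ i0 (mem E) (fun i => (f i).2 0 0) i0E) => b bE bmin.
set x := (f a).1 in amin; set y := (f b).2 in bmin.
have [[_ xt] _ _] := fP a aE; have [_ _ ey] := fP b bE.
have xle j : j \in E -> x 0 0 <= (f j).1 0 0 by exact: amin.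
have yle j : j \in E -> y 0 0 <= (f j).2 0 0 by exact: bmin.
have xy : 1 - e <= y 0 0 - x 0 0 by have := xle b bE; rewrite -/y in ey; lra.
have xE : subfam_inter F E x.
  move=> j jE; have [[xj _] _ _] := fP j jE; have [z Fz zx] := low j jE _ xt.
  exact: is_convex_between Fz xj zx (xle j jE).
have yE : subfam_inter F E y.
  move=> j jE; have [_ [yj _] _] := fP j jE.
  apply: (is_convex_between (cF j) (xE j jE) yj) (yle j jE); lra.
have xyE : simplex_in (subfam_inter F E) x (y - x).
  by case=> [k|] //=; rewrite ord1 row_id subrKC.
have := vol_simplex_ge (is_convex_subfam cF) xyE.
rewrite det_mx11 expr1n divr1 !mxE ger0_norm; last lra.
move=> /(leeD2r e%:E); apply: le_trans; rewrite -EFinD lee_fin; lra.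
Qed.

(* The comprehension in [num_good_subfams] elaborates to a classical set, hence this restatement
   with a [{set {set 'I_n}}]. *)
Lemma num_good_subfamsE d n k (F : 'I_n -> set 'rV[R]_d) :
  num_good_subfams k F =
  #|[set S : {set 'I_n} | (#|S| == k) && `[< (1%:E <= vol (subfam_inter F S))%E >]]%SET|.
Proof. by apply: eq_card => S; rewrite [RHS]inE; apply: asboolb. Qed.

(** Charging combined with the binomial ratio: [E] is a fraction [alpha / (2 * d)%:R ^+ 2] of the
    family, and in particular nonempty. *)
Lemma charging_dense d n (alpha : R) (P : {set 'I_n} -> bool) (kappa : {set 'I_n} -> 'I_n) :
  (0 < d)%N -> (2 * d <= n)%N -> 0 < alpha ->
  (forall S : {set 'I_n}, #|S| = (2 * d)%N -> P S -> kappa S \in S) ->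
  alpha * 'C(n, 2 * d)%:R <= #|[set S : {set 'I_n} | (#|S| == 2 * d)%N && P S]%SET|%:R ->
  exists T E : {set 'I_n}, [/\ E != finset.set0, alpha * n%:R <= #|E|%:R * (2 * d)%:R ^+ 2 &
    forall i, i \in E -> [/\ i \notin T, #|i |: T| = (2 * d)%N, P (i |: T) & kappa (i |: T) = i]].
Proof.
move=> d0 dn a0 kS; set G := finset _ => aG.
have md : ((2 * d).-1.+1 = 2 * d)%N by rewrite prednK// muln_gt0.
have [| |T [E [Tm ET GE]]] := @charging _ (2 * d).-1 G kappa.
- by rewrite card_ord (leq_trans (leq_pred _)).
- by move=> S; rewrite inE md => /andP[/eqP Sd PS]; split => //; exact: kS.
rewrite card_ord in GE.
have alphaE : alpha * n%:R <= #|E|%:R * (2 * d)%:R ^+ 2.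
  rewrite -md; apply: bin_ratio_le; rewrite ?md ?(ltW a0)//.
  by rewrite (le_trans aG)// -natrM ler_nat.
exists T, E; split => //.
  apply: contraTneq alphaE => ->; rewrite cards0 mul0r -ltNge mulr_gt0// ltr0n.
  by rewrite (leq_trans _ dn)// muln_gt0.
by move=> i /ET[iT iG ki]; move: iG; rewrite inE => /andP[/eqP ? ?].
Qed.

Lemma fractional_line n (alpha : R) (F : 'I_n -> set 'rV[R]_1) : (2 * 1 <= n)%N -> 0 < alpha ->
  (forall i, is_convex (F i)) ->
  alpha * 'C(n, 2 * 1)%:R <= (num_good_subfams (2 * 1) F)%:R ->
  exists S : {set 'I_n}, alpha * n%:R <= 4 * #|S|%:R /\ (1%:E <= vol (subfam_inter F S))%E.
Proof.
move=> n2 a0 cF; rewrite num_good_subfamsE => aG.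
have n0 : (0 < n)%N by apply: leq_trans n2.
(* [kappa] selects the interval with the lower left end; the one left in [T] is the charged one. *)
have /choice[kappa kP] : forall S : {set 'I_n}, exists k, #|S| = (2 * 1)%N ->
    k \in S /\ forall j, j \in S -> lower (F k) (F j).
  move=> S; have [/eqP/cards2P[i [j [_ ->]]]|S2] := eqVneq #|S| 2; last first.
    by exists (Ordinal n0); rewrite muln1 => S2'; rewrite S2' eqxx in S2.
  have [ij'|ji] := lower_total (F i) (F j); [exists i|exists j] => _;
    (split; first by rewrite !inE eqxx ?orbT); move=> k; rewrite !inE => /orP[]/eqP-> //;
    exact: lower_refl.
have [|T [E [E0 aE ET]]] := charging_dense (kappa := kappa) (ltn0Sn 0) n2 a0 _ aG.
  by move=> S /kP[].
have [i0 i0E] := set0Pn _ E0.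
have [t Tt] : exists t, T = [set t]%SET.
  have [iT + _ _] := ET _ i0E; rewrite cardsU1 iT muln1 add1n => -[/eqP/cards1P[t ->]].
  by exists t.
exists E; split; first by move: aE; rewrite muln1; lra.
apply: (vol_pairs_line i0E cF (t := t)) => i /ET[it iT /asboolP voli ki].
  have [_ /(_ t)] := kP _ iT; rewrite ki; apply.
  by rewrite Tt !inE eqxx orbT.
apply: le_trans voli _; apply: vol_mono => x xi.
by split; apply: xi; rewrite Tt !inE eqxx ?orbT.
Qed.

(** * Dimension at least two *)

(** The threshold is chosen so that [vol_simplex_le] would otherwise give volume at most one
    half. *)
Lemma simplex_of_vol d (A : set 'rV[R]_d.+1) : (1%:E <= vol A)%E ->
  exists p M, simplex_in A p M /\ (2 * 4 ^+ d.+1)^-1 <= `|\det M|.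
Proof.
move=> vA; apply: contrapT => nA.
have pow4 : 0 < 4 ^+ d.+1 :> R by rewrite exprn_gt0.
have : (vol A <= (4 ^+ d.+1 * (2 * 4 ^+ d.+1)^-1)%:E)%E.
  apply: vol_simplex_le => [|p M pM]; first by rewrite invr_ge0 mulr_ge0// ltW.
  by rewrite leNgt; apply/negP => /ltW sM; apply: nA; exists p, M.
move=> /(le_trans vA); rewrite lee_fin invfM mulrCA mulfV ?gt_eqF//.
lra.
Qed.

(** The four factors in the volume are lost in passing from volume to simplices, in [descent], in
    shrinking to a common simplex, and in returning to volume. *)
Lemma fractional_space d : exists c0 : R, 0 < c0 /\
  forall n (alpha : R) (F : 'I_n -> set 'rV[R]_d.+1), 0 < alpha -> (2 * d.+1 <= n)%N ->
  (forall i, is_convex (F i)) ->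
  alpha * 'C(n, 2 * d.+1)%:R <= (num_good_subfams (2 * d.+1) F)%:R ->
  exists S : {set 'I_n}, c0 * alpha * n%:R <= #|S|%:R /\
  (((2 * 4 ^+ d.+1)^-1 / descent_cst R d.+1 / 2 ^+ d.+1 / d.+1%:R ^+ d.+1)%:E
     <= vol (subfam_inter F S))%E.
Proof.
pose C := descent_cst R d.+1.
have C0 : 0 < C by exact: descent_cst_gt0.
have Ci0 : 0 < C^-1 by rewrite invr_gt0.
have [N [N0 pigeon]] := common_simplex (ltn0Sn d) Ci0.
exists (N%:R * (2 * d.+1)%:R ^+ 2)^-1; split.
  by rewrite invr_gt0 mulr_gt0 ?ltr0n// exprn_gt0// ltr0n muln_gt0.
move=> n alpha F a0 dn cF; rewrite num_good_subfamsE => aG.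
set s1 : R := (2 * 4 ^+ d.+1)^-1.
have s10 : 0 < s1 by rewrite invr_gt0 mulr_gt0// exprn_gt0.
pose good (S : {set 'I_n}) := `[< (1%:E <= vol (subfam_inter F S))%E >].
have /choice[f fP] : forall S : {set 'I_n}, exists pM : 'rV[R]_d.+1 * 'M[R]_d.+1,
    good S -> simplex_in (subfam_inter F S) pM.1 pM.2 /\ s1 <= `|\det pM.2|.
  move=> S; have [/asboolP/simplex_of_vol[p [M pM]]|_] := boolP (good S).
    by exists (p, M).
  by exists (0, 0).
pose Rb : R := \sum_S \sum_o \sum_k `|vertex (f S).1 (f S).2 o 0 k|.
have RbP S o k : `|vertex (f S).1 (f S).2 o 0 k| <= Rb.
  rewrite /Rb (bigD1 S)//= (bigD1 o)//= (bigD1 k)//= -!addrA lerDl.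
  by rewrite !addr_ge0 ?sumr_ge0// => *; rewrite !sumr_ge0// => *; rewrite ?sumr_ge0.
(* Truncating to a large cube makes the sets bounded without losing the chosen simplices. *)
pose F' i (x : 'rV[R]_d.+1) := F i x /\ forall k, `|x 0 k| <= Rb.
have cF' i : is_convex (F' i).
  move=> Y X x XF [w [w0 w1 xE]]; split.
    by apply: (cF i Y X) => [y|]; [exact: (XF y).1|exists w].
  move=> k; rewrite xE summxE (le_trans (ler_norm_sum _ _ _))//.
  rewrite -[leRHS]mul1r -w1 mulr_suml; apply: ler_sum => y _.
  by rewrite mxE normrM ger0_norm// ler_wpM2l//; exact: (XF y).2.
have n0 : (0 < n)%N by apply: leq_trans dn; rewrite muln_gt0.
have /choice[g gP] : forall S : {set 'I_n}, exists kt : 'I_n * R,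
    #|S| = (2 * d.+1)%N -> good S -> [/\ kt.1 \in S,
    exists p M, simplex_in (fun x => x 0 ord0 <= kt.2 /\ forall i, i \in S -> F' i x) p M /\
      s1 / C <= `|\det M| &
    forall p M, simplex_in (fun x => x 0 ord0 <= kt.2 /\ forall i, i \in S :\ kt.1 -> F' i x) p M ->
      `|\det M| < s1].
  move=> S; have [[Sd gS]|nS] := pselect (#|S| = (2 * d.+1)%N /\ good S); last first.
    by exists (Ordinal n0, 0) => Sd gS; case: nS.
  have [fS sS] := fP S gS.
  have [||k [t [kS h1 h2]]] := @descent _ _ ord0 _ S F' Rb s1 Sd cF' _ s10.
  - by move=> i _ x [].
  - exists (f S).1, (f S).2; split => // o i iS; split; first exact: fS.
    by move=> k; exact: RbP.
  by exists (k, t).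
have [|T [E [E0 aE ET]]] := charging_dense (kappa := fun S => (g S).1) (ltn0Sn d) dn a0 _ aG.
  by move=> S Sd /(gP S Sd)[].
have [i0 i0E] := set0Pn _ E0.
(* At the highest level [t], [descent] for [m] bounds all simplices of [A] by [s1]. The simplices
   found at the lower levels of the other indices still lie in [A]. *)
case: (@arg_maxP _ _ _ i0 (mem E) (fun i => (g (i |: T)).2) i0E) => m mE mmax.
set t := (g (m |: T)).2 in mmax.
pose A (x : 'rV[R]_d.+1) := x 0 ord0 <= t /\ forall j, j \in T -> F' j x.
have As p M : simplex_in A p M -> `|\det M| <= s1.
  move=> pM; have [mT mc mg mk] := ET _ mE; have [_ _ h] := gP _ mc mg.
  apply/ltW/(h p) => o; split; first exact: (pM o).1.
  by rewrite mk finset.setU1K// => i iT; exact: (pM o).2.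
have AF i : i \in E -> exists p M, simplex_in (fun x => A x /\ F' i x) p M /\
    C^-1 * s1 <= `|\det M|.
  move=> iE; have [iT ic ig ik] := ET _ iE; have [_ [p [M [pM sM]]] _] := gP _ ic ig.
  exists p, M; rewrite mulrC; split => // o; have [ho hF] := pM o; split.
    split; first by rewrite (le_trans ho)//; exact: mmax.
    by move=> j jT; apply: hF; rewrite !inE jT orbT.
  by apply: hF; rewrite !inE eqxx.
have [E' [EE' [p [M [pM sM]]]]] := pigeon _ E i0 A F' s1 s10 i0E cF' As AF.
exists E'; split.
  rewrite -mulrA mulrC ler_pdivrMr; last first.
    by rewrite mulr_gt0 ?ltr0n// exprn_gt0// ltr0n muln_gt0.
  by rewrite (le_trans aE)// [leRHS]mulrA ler_wpM2r ?exprn_ge0// -natrM ler_nat.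
have pE' : simplex_in (subfam_inter F E') p M by move=> o i iE'; exact: (pM i iE' o).1.
apply: le_trans (vol_simplex_ge (is_convex_subfam cF) pE').
by rewrite lee_fin ler_wpM2r ?invr_ge0 ?exprn_ge0//; rewrite [C^-1 * s1]mulrC in sM.
Qed.

(** Since [2 <= d], numerical constants are absorbed into powers of [d]. The exponents add up as 15
    = 3 + 2 + 1 + 6 + 1 + 1 + 1. *)
Lemma space_cst_le d (K : realType) : (1 < d)%N ->
  2 * 4 ^+ d * descent_cst K d * 2 ^+ d * d%:R ^+ d <= (d%:R ^+ d) ^+ 15 :> K.
Proof.
move=> d1; have x2 : 2 <= d%:R :> K by rewrite ler_nat.
set x := d%:R : K in x2 *.
have x0 : 0 <= x by exact: le_trans x2.
have x1 : 1 <= x by apply: le_trans x2; rewrite ler1n.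
have powle (a : K) m : 0 <= a -> a <= x ^+ m -> a ^+ d <= (x ^+ d) ^+ m.
  by move=> a0 am; rewrite exprAC lerXn2r ?nnegrE ?exprn_ge0.
have xm k : 2 ^+ k <= x ^+ k by rewrite lerXn2r ?nnegrE.
have h4 : 2 * 4 ^+ d <= (x ^+ d) ^+ 3.
  apply: (@le_trans _ _ (8 ^+ d)); last first.
    by apply: powle => //; rewrite (le_trans _ (xm 3%N))// !exprS expr0; lra.
  have -> : 8 = 2 * 4 :> K by ring.
  rewrite exprMn ler_wpM2r ?exprn_ge0//.
  by rewrite -[leLHS]expr1 ler_weXn2l ?ler1n// ltnW.
have h3 : 3 ^+ d <= (x ^+ d) ^+ 2.
  by apply: powle => //; rewrite (le_trans _ (xm 2%N))// !exprS expr0; lra.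
have hf : (d`!)%:R <= (x ^+ d) ^+ 1.
  have dd : (d ^ d = \prod_(i < d) d)%N by rewrite prod_nat_const card_ord.
  rewrite expr1 -natrX ler_nat dd fact_prod big_add1 big_mkord.
  by apply: leq_prod => i _; exact: ltn_ord.
have hm : (3 * x ^+ 2 / d.+1%:R^-1 + x) ^+ d <= (x ^+ d) ^+ 6.
  apply: powle.
    by rewrite addr_ge0// divr_ge0 ?invr_ge0// mulr_ge0// exprn_ge0.
  rewrite invrK -[d.+1%:R]natr1 -/x.
  have x22 : 2 * x <= x ^+ 2 by rewrite expr2 ler_wpM2r.
  have x23 : 2 * x ^+ 2 <= x ^+ 3 by rewrite [x ^+ 3]exprS ler_wpM2r// exprn_ge0.
  have x36 : 8 * x ^+ 3 <= x ^+ 6.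
    rewrite (exprD x 3 3) ler_wpM2r ?exprn_ge0// (le_trans _ (xm 3%N))// !exprS expr0; lra.
  have -> : 3 * x ^+ 2 * (x + 1) + x = 3 * x ^+ 3 + 3 * x ^+ 2 + x by ring.
  by lra.
have h2 : 2 ^+ d <= (x ^+ d) ^+ 1 by apply: powle.
rewrite /descent_cst /helly_cst -/x.
have -> : (x ^+ d) ^+ 15 = (x ^+ d) ^+ 3 * ((x ^+ d) ^+ 2 *
    ((x ^+ d) ^+ 1 * (x ^+ d) ^+ 6) * (x ^+ d) ^+ 1) * (x ^+ d) ^+ 1 * x ^+ d.
  by rewrite -!exprD -exprSr.
have m0 : 0 <= (3 * x ^+ 2 / d.+1%:R^-1 + x) ^+ d.
  by rewrite exprn_ge0// addr_ge0// divr_ge0 ?invr_ge0// mulr_ge0// exprn_ge0.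
set m := (_ + x) ^+ d in hm m0 *.
have [p2 p3 p4] : [/\ 0 <= 2 ^+ d :> K, 0 <= 3 ^+ d :> K & 0 <= 4 ^+ d :> K].
  by split; exact: exprn_ge0.
have h1 : (d`!)%:R * m <= (x ^+ d) ^+ 1 * (x ^+ d) ^+ 6 by exact: ler_pM.
have h5 := ler_pM (mulr_ge0 p3 (mulr_ge0 (ler0n _ _) m0)) p2
  (ler_pM p3 (mulr_ge0 (ler0n _ _) m0) h3 h1) h2.
have q5 := mulr_ge0 (mulr_ge0 p3 (mulr_ge0 (ler0n K d`!) m0)) p2.
have q4 : 0 <= 2 * 4 ^+ d :> K by exact: mulr_ge0.
apply: ler_wpM2r; first exact: exprn_ge0.
exact: (ler_pM (mulr_ge0 q4 q5) p2 (ler_pM q4 q5 h4 h5) h2).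
Qed.

Theorem theorem1 :
  exists c1 : R, 0 < c1 /\
  forall d : nat, (0 < d)%N ->
  exists c0 : R, 0 < c0 /\
  forall (n : nat) (alpha : R) (F : 'I_n -> set 'rV[R]_d),
    0 < alpha -> alpha <= 1 ->
    (2 * d <= n)%N ->
    (forall i, convex_set (F i)) ->
    alpha * ('C(n, 2 * d))%:R <= (num_good_subfams (2 * d) F)%:R ->
    exists S : {set 'I_n},
      c0 * alpha * n%:R <= #|S|%:R /\
      ((d%:R `^ (- (c1 * d%:R)))%:E <= vol (subfam_inter F S))%E.
Proof.
(* [15] is the exponent in [space_cst_le], used from dimension two on. In dimension one the required
   volume is exactly 1. *)
exists 15; split=> // -[|[|d]] // _.
  exists 4^-1; split=> [|n alpha F a0 _ n2 cF aG]; first by rewrite invr_gt0.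
  have [S [aS volS]] := fractional_line n2 a0 (fun i => convex_setP (cF i)) aG.
  exists S; rewrite powR1; split => //.
  by rewrite -mulrA; move: aS; set u := alpha * _; lra.
have [c0 [c00 H]] := fractional_space d.+1; exists c0; split => // n alpha F a0 _ dn cF aG.
have [S [aS volS]] := H n alpha F a0 dn (fun i => convex_setP (cF i)) aG.
exists S; split => //; apply: le_trans volS; rewrite lee_fin.
rewrite powRN -natrM powR_mulrn// mulnC exprM.
have := @space_cst_le d.+2 R isT; have := descent_cst_gt0 R (ltn0Sn d.+1).
move: (descent_cst _ _) => C C0; rewrite -!invfM => h.
rewrite lef_pV2// posrE; first by rewrite !exprn_gt0.
have p k : 0 < k.+1%:R ^+ d.+2 :> R by rewrite exprn_gt0.
exact: (mulr_gt0 (mulr_gt0 (mulr_gt0 (mulr_gt0 (ltr0n R 2) (p 3%N)) C0) (p 1%N)) (p d.+1)).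
Qed.
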